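(* Let $(X,\varphi)$ be a mixing Wieler solenoid, let $\mathbf P\subseteq X$ be a finite nonempty $\varphi$-invariant set, and let $G^s(\mathbf P)$ and $G_k(\mathbf P)$ ($k\in\mathbb N=\{0,1,2,\dots\}$) be the groupoids defined in the context. Then \[ G_0(\mathbf P)\subset G_1(\mathbf P)\subset G_2(\mathbf P)\subset\cdots \] is a nested sequence of étale subgroupoids of $G^s(\mathbf P)$ (each with the subspace topology from $G^s(\mathbf P)$) such that $G^s(\mathbf P)=\bigcup_{k=0}^\infty G_k(\mathbf P)$, and for each $k$ the map $\varphi^k\times\varphi^k:G_k(\mathbf P)\to G_0(\mathbf P)$ is an isomorphism of topological groupoids.
   Context: Setting. $(Y,d_Y)$ is an infinite compact metric space and $g:Y\to Y$ is a continuous surjection satisfying Wieler's axioms: there are constants $\beta>0$, an integer $K\ge 1$ and $0<\gamma<1$ such that (Axiom 1) if $d_Y(x,y)\le\beta$ then $d_Y(g^K(x),g^K(y))\le\gamma^K d_Y(g^{2K}(x),g^{2K}(y))$; (Axiom 2) for all $x\in Y$ and $0<\epsilon\le\beta$, $g^K(B(g^K(x),\epsilon))\subseteq g^{2K}(B(x,\gamma\epsilon))$. The Wieler solenoid is $X=\varprojlim(Y,g)=\{\mathbf x=(x_n)_{n\in\mathbb N}: x_n\in Y,\ g(x_{n+1})=x_n\}$ with $\varphi(x_0,x_1,\dots)=(g(x_0),x_0,x_1,\dots)$ and metric $d_X(\mathbf x,\mathbf y)=\sum_{i=0}^K\gamma^i d'_X(\varphi^i(\mathbf x),\varphi^i(\mathbf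 y))$, $d'_X(\mathbf x,\mathbf y)=\sup_n\gamma^n d_Y(x_n,y_n)$. By Wieler, it is a Smale space with constants $\epsilon_X=\beta/2$, $\lambda=\gamma$; for $0<\epsilon\le\beta/2$ the local stable and unstable sets are $X^s(\mathbf x,\epsilon)=\{\mathbf y: y_m=x_m\ (0\le m\le K-1),\ d_X(\mathbf x,\mathbf y)<\epsilon\}$ and $X^u(\mathbf x,\epsilon)=\{\mathbf y: d_Y(x_n,y_n)<\epsilon\ \forall n,\ d_X(\mathbf x,\mathbf y)<\epsilon\}$; the bracket $[\mathbf x,\mathbf y]$ is the point such that $X^s(\mathbf x,\epsilon)\cap X^u(\mathbf y,\epsilon)=\{[\mathbf x,\mathbf y]\}$ whenever this intersection is nonempty. Mixing means: for all nonempty open $U,V\subseteq X$ there is $N$ with $\varphi^n(U)\cap V\ne\emptyset$ for all $n\ge N$. Groupoid $G^s(\mathbf P)$. Write $\mathbf x\sim_s\mathbf y$ if $d_X(\varphi^n(\mathbf x),\varphi^n(\mathbf y))\to0$ and $\mathbf x\sim_u\mathbf y$ if $d_X(\varphi^{-n}(\mathbf x),\varphi^{-n}(\mathbf y))\to0$ as $n\to\infty$. $\mathbf P$ is a finite nonempty $\varphi$-invariant set of periodic points; $X^u(\mathbf P)=\{\mathbf x:\mathbf x\sim_u\mathbf p\text{ for some }\mathbf p\in\mathbf P\}$, with the locally compact Hausdorff topology having the sets $X^u(\mathbf x,\delta)$ (small $\delta>0$) as neighborhood base (not the topology inherited from $X$). $G^s(\mathbf P)=\{(\mathbf x,\mathbf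 y)\in X^u(\mathbf P)\times X^u(\mathbf P):\mathbf x\sim_s\mathbf y\}$ has the étale topology with neighborhood base the sets $\{(h(\mathbf z),\mathbf z):\mathbf z\in X^u(\mathbf y,\delta)\}$, where $(\mathbf x,\mathbf y)\in G^s(\mathbf P)$, $k$ satisfies $\varphi^k(\mathbf x)\in X^s(\varphi^k(\mathbf y),\epsilon_X/2)$, $\delta>0$ satisfies $\varphi^k(X^u(\mathbf y,\delta))\subseteq X^u(\varphi^k(\mathbf y),\epsilon_X/2)$, and $h(\mathbf z)=\varphi^{-k}([\varphi^k(\mathbf z),\varphi^k(\mathbf x)])$. Relation $\sim_0$. Fix $K_0\in\mathbb N$ with $K_0\ge K$ such that $x_i=y_i$ for all $i\le K_0$ implies $d_X(\mathbf x,\mathbf y)<\beta/4$; fix $0<\epsilon_Y<\beta/4$ with $\varphi^{K_0}(X^u(\mathbf x,\epsilon_Y))\subseteq X^u(\varphi^{K_0}(\mathbf x),\beta/4)$ for all $\mathbf x\in X$. Let $\pi_0:X^u(\mathbf P)\to Y$, $\pi_0(\mathbf x)=x_0$. For $\mathbf x,\mathbf y\in X^u(\mathbf P)$, $\mathbf x\sim_0\mathbf y$ means: (1) $\pi_0(\mathbf x)=\pi_0(\mathbf y)$; (2) there exist $0<\delta_{\mathbf x}<\epsilon_Y$ and an open set $U\subseteq X^u(\mathbf y,\epsilon_Y)$ with $\pi_0(X^u(\mathbf x,\delta_{\mathbf x}))=\pi_0(U)$. $G_0(\mathbf P)=\{(\mathbf x,\mathbf y):\mathbf x\sim_0\mathbf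 y\}$, and for $k\in\mathbb N$, $G_k(\mathbf P)=\{(\mathbf x,\mathbf y)\in X^u(\mathbf P)\times X^u(\mathbf P):\varphi^k(\mathbf x)\sim_0\varphi^k(\mathbf y)\}$. *)

(* Defs.v *)
From HB Require Import structures.
From mathcomp Require Import all_boot all_order all_algebra.
From mathcomp Require Import all_classical all_reals all_analysis.

Set Implicit Arguments.
Unset Strict Implicit.
Unset Printing Implicit Defensive.

Import Order.TTheory GRing.Theory Num.Theory.
Import numFieldNormedType.Exports.

Local Open Scope classical_set_scope.
Local Open Scope ring_scope.

Definition homeomorphism (S T : topologicalType) (f : S -> T) : Prop :=
  continuous f /\
  exists f' : T -> S, [/\ continuous f', cancel f f' & cancel f' f].

Definition local_homeomorphism (S T : topologicalType) (f : S -> T) : Prop :=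
  forall x : S, exists U : set S,
    [/\ open U, U x, open (f @` U), {within U, continuous f} &
        exists f' : T -> S,
          {within f @` U, continuous f'} /\ {in U, cancel f f'}].

(* A small groupoid whose sets of objects and arrows carry topologies; that the
   structure maps are continuous is the predicate [topological_groupoid]. *)
Record groupoid := Groupoid {
  gobj : topologicalType;
  garr :> topologicalType;
  grange : garr -> gobj;
  gsource : garr -> gobj;
  gunit : gobj -> garr;
  ginv : garr -> garr;
  gmul : forall a b : garr, gsource a = grange b -> garr;
  grange_unit : forall x, grange (gunit x) = x;
  gsource_unit : forall x, gsource (gunit x) = x;
  grange_inv : forall a, grange (ginv a) = gsource a;
  gsource_inv : forall a, gsource (ginv a) = grange a;
  grange_mul : forall a b (ab : gsource a = grange b),
    grange (gmul ab) = grange a;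
  gsource_mul : forall a b (ab : gsource a = grange b),
    gsource (gmul ab) = gsource b;
  gmul1 : forall a (e : gsource a = grange (gunit (gsource a))), gmul e = a;
  gmul1l : forall a (e : gsource (gunit (grange a)) = grange a), gmul e = a;
  gmulV : forall a (e : gsource a = grange (ginv a)),
    gmul e = gunit (grange a);
  gmulVl : forall a (e : gsource (ginv a) = grange a),
    gmul e = gunit (gsource a);
  gmulA : forall a b c (ab : gsource a = grange b) (bc : gsource b = grange c)
    (ab_c : gsource (gmul ab) = grange c)
    (a_bc : gsource a = grange (gmul bc)), gmul ab_c = gmul a_bc }.

Definition composable (G : groupoid) : set (G * G) :=
  [set p | gsource p.1 = grange p.2].

Definition composable_mul (G : groupoid) (p : set_type (@composable G)) : G :=
  gmul (set_valP p).

Record topological_groupoid (G : groupoid) : Prop := TopologicalGroupoid {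
  continuous_grange : continuous (@grange G);
  continuous_gsource : continuous (@gsource G);
  continuous_gunit : continuous (@gunit G);
  continuous_ginv : continuous (@ginv G);
  continuous_gmul : continuous (@composable_mul G) }.

Record etale (G : groupoid) : Prop := Etale {
  etale_topological : topological_groupoid G;
  etale_range : local_homeomorphism (@grange G);
  etale_source : local_homeomorphism (@gsource G) }.

(* Subgroupoids are wide, i.e. contain all the units of the ambient groupoid. *)
Record subgroupoid (G : groupoid) (H : set G) : Prop := Subgroupoid {
  sub_unit : forall x, H (gunit x);
  sub_inv : forall a, H a -> H (ginv a);
  sub_mul : forall a b (ab : gsource a = grange b), H a -> H b -> H (gmul ab) }.

(* [set_type H] carries the library's topology of a subspace. *)
Section subgroupoid_groupoid.
Variables (G : groupoid) (H : set G) (sH : subgroupoid H).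
Implicit Types (a b c : set_type H) (x : gobj G).

Let arr (a : G) (Ha : H a) : set_type H := SigSub (mem_set Ha).

Let rng a := grange (set_val a).
Let src a := gsource (set_val a).
Let one x : set_type H := arr (sub_unit sH x).
Let inv a : set_type H := arr (sub_inv sH (set_valP a)).
Let mul a b (ab : src a = rng b) : set_type H :=
  arr (sub_mul sH ab (set_valP a) (set_valP b)).

Let mul1 a (e : src a = rng (one (src a))) : mul e = a.
Proof. by apply: val_inj; exact: gmul1. Qed.

Let mul1l a (e : src (one (rng a)) = rng a) : mul e = a.
Proof. by apply: val_inj; exact: gmul1l. Qed.

Let mulV a (e : src a = rng (inv a)) : mul e = one (rng a).
Proof. by apply: val_inj; exact: gmulV. Qed.

Let mulVl a (e : src (inv a) = rng a) : mul e = one (src a).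
Proof. by apply: val_inj; exact: gmulVl. Qed.

Let mulA a b c (ab : src a = rng b) (bc : src b = rng c)
  (ab_c : src (mul ab) = rng c) (a_bc : src a = rng (mul bc)) :
  mul ab_c = mul a_bc.
Proof. by apply: val_inj; exact: gmulA. Qed.

Definition subgroupoid_groupoid : groupoid :=
  @Groupoid (gobj G) (set_type H) rng src one inv mul
    (fun x => grange_unit x) (fun x => gsource_unit x)
    (fun a => grange_inv _) (fun a => gsource_inv _)
    (fun a b ab => grange_mul _) (fun a b ab => gsource_mul _)
    mul1 mul1l mulV mulVl mulA.

End subgroupoid_groupoid.

Record topological_groupoid_iso (G H : groupoid)
    (f0 : gobj G -> gobj H) (f : G -> H) : Prop := TopologicalGroupoidIso {
  iso_range : forall a, grange (f a) = f0 (grange a);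
  iso_source : forall a, gsource (f a) = f0 (gsource a);
  iso_mul : forall a b (ab : gsource a = grange b)
    (fab : gsource (f a) = grange (f b)), f (gmul ab) = gmul fab;
  iso_homeo_obj : homeomorphism f0;
  iso_homeo : homeomorphism f }.

Record wieler (R : realType) := Wieler {
  wspace :> metricType R;
  wmap : wspace -> wspace;
  wbeta : R;
  wK : nat;
  wgamma : R;
  wieler_compact : compact [set: wspace];
  wieler_infinite : infinite_set [set: wspace];
  wieler_continuous : continuous wmap;
  wieler_surjective : forall y, exists x, wmap x = y;
  wbeta_gt0 : 0 < wbeta;
  wK_gt0 : (0 < wK)%N;
  wgamma_gt0 : 0 < wgamma;
  wgamma_lt1 : wgamma < 1;
  wieler_axiom1 : forall x y, mdist x y <= wbeta ->
    mdist (iter wK wmap x) (iter wK wmap y) <=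
    wgamma ^+ wK * mdist (iter (2 * wK) wmap x) (iter (2 * wK) wmap y);
  wieler_axiom2 : forall x e, 0 < e <= wbeta ->
    iter wK wmap @` ball (iter wK wmap x) e `<=`
    iter (2 * wK) wmap @` ball x (wgamma * e) }.

Record solenoid (R : realType) (W : wieler R) := Solenoid {
  coord :> nat -> W;
  coordP : forall n, wmap (coord n.+1) = coord n }.

HB.instance Definition _ (R : realType) (W : wieler R) :=
  gen_eqMixin (solenoid W).
HB.instance Definition _ (R : realType) (W : wieler R) :=
  gen_choiceMixin (solenoid W).

Section solenoid_metric.
Variables (R : realType) (W : wieler R).
Local Notation X := (solenoid W).
Local Notation gamma := (wgamma W).
Implicit Types x y z : X.

Lemma solenoid_ext x y : (forall n, x n = y n) -> x = y.
Proof.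
case: x y => [x xP] [y yP] /= /funext xy; subst y.
by congr Solenoid; exact: Prop_irrelevance.
Qed.

Definition phi x : X := @Solenoid R W
  (fun n => if n is m.+1 then x m else wmap (x 0%N))
  (fun n => match n with 0 => erefl | m.+1 => coordP x m end).

Definition phiV x : X := @Solenoid R W (fun n => x n.+1) (fun n => coordP x n.+1).

Lemma phiK : cancel phi phiV.
Proof. by move=> x; apply: solenoid_ext. Qed.

Lemma phiVK : cancel phiV phi.
Proof. by move=> x; apply: solenoid_ext => -[|n] //=; exact: coordP. Qed.

(* d'_X; the set is bounded since W is compact, so [sup] is the supremum. *)
Definition dist' x y : R := sup [set gamma ^+ n * mdist (x n) (y n) | n in setT].

Definition dist x y : R :=
  \sum_(0 <= i < (wK W).+1) gamma ^+ i * dist' (iter i phi x) (iter i phi y).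

Lemma wieler_bounded : exists M : R, forall p q : W, mdist p q <= M.
Proof.
have [p0 _] := infinite_setN0 (@wieler_infinite R W).
have /compact_near_coveringP := @wieler_compact R W.
move=> /(_ nat \oo (fun n q => mdist p0 q <= n%:R) _) bnd.
have [p _|M _ MP] := bnd.
  exists (ball p 1, [set n | mdist p0 p + 1 <= n%:R]) => /=.
    by split; [exact: nbhsx_ballx | exact: nbhs_infty_ger].
  move=> [q n] /= [+ le_n]; rewrite ballEmdist /= => /ltW pq.
  apply: le_trans (metric_triangle _ p _) _.
  by apply: le_trans le_n; rewrite lerD2l.
have {}MP p : mdist p0 p <= M%:R by apply: (MP M) => //=.
exists (M%:R + M%:R) => p q; apply: le_trans (metric_triangle _ p0 _) _.
by rewrite lerD// metric_sym.
Qed.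

Lemma dist'_has_sup x y :
  has_sup [set gamma ^+ n * mdist (x n) (y n) | n in setT].
Proof.
split; first by exists (gamma ^+ 0 * mdist (x 0) (y 0)), 0%N.
have [M MP] := wieler_bounded; exists M => _ [n _ <-].
apply: le_trans (MP (x n) (y n)); apply: ler_piMl; first exact: mdist_ge0.
by rewrite exprn_ile1// ltW// (wgamma_gt0, wgamma_lt1).
Qed.

Lemma dist'_ub x y n : gamma ^+ n * mdist (x n) (y n) <= dist' x y.
Proof. by apply: ub_le_sup; [case: (dist'_has_sup x y) | exists n]. Qed.

Lemma dist'_le x y M :
  (forall n, gamma ^+ n * mdist (x n) (y n) <= M) -> dist' x y <= M.
Proof.
move=> MP; apply: ge_sup; first by case: (dist'_has_sup x y).
by move=> _ [n _ <-].
Qed.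

Lemma dist'_ge0 x y : 0 <= dist' x y.
Proof.
by apply: le_trans (dist'_ub x y 0); rewrite expr0 mul1r mdist_ge0.
Qed.

Lemma dist'xx x : dist' x x = 0.
Proof.
apply/eqP; rewrite eq_le dist'_ge0 andbT; apply: dist'_le => n.
by rewrite mdistxx mulr0.
Qed.

Lemma dist'_sym x y : dist' x y = dist' y x.
Proof. by congr sup; apply: eq_imagel => n _; rewrite metric_sym. Qed.

Lemma dist'_triangle y x z : dist' x z <= dist' x y + dist' y z.
Proof.
apply: dist'_le => n.
apply: le_trans (lerD (dist'_ub x y n) (dist'_ub y z n)).
rewrite -mulrDr ler_wpM2l ?metric_triangle// exprn_ge0//.
by rewrite ltW// wgamma_gt0.
Qed.

Lemma dist'_le_dist x y : dist' x y <= dist x y.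
Proof.
rewrite /dist big_nat_recl//= expr0 mul1r lerDl sumr_ge0// => i _.
by rewrite mulr_ge0 ?dist'_ge0// exprn_ge0// ltW// wgamma_gt0.
Qed.

Let distxx x : dist x x = 0.
Proof. by rewrite /dist big1// => i _; rewrite dist'xx mulr0. Qed.

Let dist_positivity x y : dist x y = 0 -> x = y.
Proof.
move=> xy; apply: solenoid_ext => n; apply: mdist_positivity.
have := le_trans (dist'_ub x y n) (dist'_le_dist x y).
rewrite xy pmulr_rle0 ?exprn_gt0 ?wgamma_gt0// => le0.
by apply/eqP; rewrite eq_le le0 mdist_ge0.
Qed.

Let dist_sym x y : dist x y = dist y x.
Proof. by apply: eq_bigr => i _; rewrite dist'_sym. Qed.

Let dist_triangle y x z : dist x z <= dist x y + dist y z.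
Proof.
rewrite /dist -big_split/=; apply: ler_sum => i _.
by rewrite -mulrDr ler_wpM2l ?dist'_triangle// exprn_ge0// ltW// wgamma_gt0.
Qed.

HB.instance Definition _ := @isMetric.Build R (solenoid W)
  dist distxx dist_positivity dist_sym dist_triangle.

Lemma mdist_solenoid x y : mdist x y = dist x y.
Proof. by []. Qed.

End solenoid_metric.

Definition mixing (T : topologicalType) (f : T -> T) : Prop :=
  forall U V : set T, open U -> open V -> U !=set0 -> V !=set0 ->
  exists N, forall n, (N <= n)%N -> (iter n f @` U) `&` V !=set0.

Section smale_structure.
Variables (R : realType) (W : wieler R).
Local Notation X := (solenoid W).
Implicit Types x y z : X.

(* [local_stable] and [local_unstable] are only meant for 0 < e <= epsX. *)
Definition epsX : R := wbeta W / 2.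

Definition local_stable x (e : R) : set X :=
  [set y : X | (forall m, (m < wK W)%N -> y m = x m) /\ mdist x y < e].

Definition local_unstable x (e : R) : set X :=
  [set y : X | (forall n, mdist (x n) (y n) < e) /\ mdist x y < e].

Definition bracket_set x y : set X :=
  local_stable x epsX `&` local_unstable y epsX.

(* [bracket_set x y] has at most one point, and contains the corresponding
   intersections for smaller radii; if it is empty the value is irrelevant. *)
Definition bracket x y : X := xget x (bracket_set x y).

Definition stable_equiv x y : Prop :=
  mdist (iter n (@phi R W) x) (iter n (@phi R W) y) @[n --> \oo] --> (0 : R).

Definition unstable_equiv x y : Prop :=
  mdist (iter n (@phiV R W) x) (iter n (@phiV R W) y) @[n --> \oo] --> (0 : R).

Lemma stable_equiv_refl x : stable_equiv x x.
Proof. by rewrite /stable_equiv; under eq_fun do rewrite mdistxx; exact: cvg_cst. Qed.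

Lemma stable_equiv_sym x y : stable_equiv x y -> stable_equiv y x.
Proof. by rewrite /stable_equiv; under eq_fun do rewrite metric_sym. Qed.

Lemma stable_equiv_trans y x z :
  stable_equiv x y -> stable_equiv y z -> stable_equiv x z.
Proof.
move=> xy yz; have := cvgD xy yz _; rewrite addr0 => xyz.
apply: (squeeze_cvgr _ (cvg_cst 0) (xyz _)); apply: nearW => n /=.
by rewrite mdist_ge0; exact: metric_triangle.
Qed.

Lemma unstable_equiv_phi x y :
  unstable_equiv x y -> unstable_equiv (phi x) (phi y).
Proof.
move=> xy; rewrite /unstable_equiv -cvg_shiftS /=.
by under eq_fun do rewrite -!iterS !iterSr !phiK.
Qed.

End smale_structure.

Record invariantSet (R : realType) (W : wieler R) := InvariantSet {
  ipoints : set (solenoid W);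
  ipoints_finite : finite_set ipoints;
  ipoints_neq0 : ipoints !=set0;
  ipoints_phi : @phi R W @` ipoints `<=` ipoints }.

Definition global_unstable (R : realType) (W : wieler R)
    (P : invariantSet W) : set (solenoid W) :=
  [set x | exists2 p, ipoints P p & unstable_equiv x p].

(* X^u(P) is a record, and not [set_type (global_unstable P)], since its
   topology is not the one inherited from the solenoid. *)
Record unstableSpace (R : realType) (W : wieler R) (P : invariantSet W) :=
  UnstableSpace {
    upoint :> solenoid W;
    upointP : global_unstable P upoint }.

HB.instance Definition _ (R : realType) (W : wieler R) (P : invariantSet W) :=
  gen_eqMixin (unstableSpace P).
HB.instance Definition _ (R : realType) (W : wieler R) (P : invariantSet W) :=
  gen_choiceMixin (unstableSpace P).

Section unstable_space.
Variables (R : realType) (W : wieler R) (P : invariantSet W).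
Local Notation XuP := (unstableSpace P).

(* The set X^u(x, delta) for x in X^u(P); X^u(x, delta) is contained in X^u(P)
   for delta <= epsX. *)
Definition unstable_ball (x : XuP) (delta : R) : set XuP :=
  [set y : XuP | local_unstable x delta y].

(* These sets are open in the topology they generate, hence a base of it. *)
Definition unstable_base : set (set XuP) :=
  [set B | exists x delta, 0 < delta <= epsX W /\ B = unstable_ball x delta].

HB.instance Definition _ :=
  @isSubBaseTopological.Build XuP (set XuP) unstable_base id.

Lemma unstable_inj (x y : XuP) : upoint x = upoint y -> x = y.
Proof.
case: x y => [x xP] [y yP] /= xy; subst y.
by congr UnstableSpace; exact: Prop_irrelevance.
Qed.

Lemma global_unstable_phi (x : XuP) : global_unstable P (phi x).
Proof.
case: (upointP x) => p Pp xp; exists (phi p); last exact: unstable_equiv_phi.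
by apply: ipoints_phi; exists p.
Qed.

Definition phiU (x : XuP) : XuP := UnstableSpace (global_unstable_phi x).

Definition Gs : set (XuP * XuP) := [set p : XuP * XuP | stable_equiv p.1 p.2].

End unstable_space.

(* The arrows of G^s(P); again a record, since the topology is not the one
   inherited from the product. *)
Record stableArrow (R : realType) (W : wieler R) (P : invariantSet W) :=
  StableArrow {
    apair : unstableSpace P * unstableSpace P;
    apairP : Gs apair }.

HB.instance Definition _ (R : realType) (W : wieler R) (P : invariantSet W) :=
  gen_eqMixin (stableArrow P).
HB.instance Definition _ (R : realType) (W : wieler R) (P : invariantSet W) :=
  gen_choiceMixin (stableArrow P).

Section stable_groupoid.
Variables (R : realType) (W : wieler R) (P : invariantSet W).
Local Notation XuP := (unstableSpace P).
Local Notation A := (stableArrow P).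
Local Notation phi := (@phi R W).
Local Notation phiV := (@phiV R W).

Lemma stableArrow_inj : injective (@apair R W P).
Proof.
case=> [a aP] [b bP] /= ab; subst b.
by congr StableArrow; exact: Prop_irrelevance.
Qed.

Definition holonomy (x : solenoid W) (k : nat) (z : solenoid W) : solenoid W :=
  iter k phiV (bracket (iter k phi z) (iter k phi x)).

(* The last condition says that the holonomy map, i.e. the bracket in its
   formula, is defined on X^u(y, delta). *)
Definition holonomy_domain (x y : XuP) (k : nat) (delta : R) : Prop :=
  [/\ 0 < delta <= epsX W,
      local_stable (iter k phi y) (epsX W / 2) (iter k phi x),
      iter k phi @` local_unstable y delta `<=`
        local_unstable (iter k phi y) (epsX W / 2) &
      forall z, local_unstable y delta z ->
        bracket_set (iter k phi z) (iter k phi x) !=set0].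

(* The sets {(h(z), z) : z in X^u(y, delta)}; they too form a base of the
   topology they generate. *)
Definition stable_base : set (set A) :=
  [set B | exists x y k delta, [/\ Gs (x, y), holonomy_domain x y k delta &
    B = [set a : A | unstable_ball y delta (apair a).2 /\
                     (apair a).1 = holonomy x k (apair a).2 :> solenoid W]]].

HB.instance Definition _ :=
  @isSubBaseTopological.Build A (set A) stable_base id.

Let rng (a : A) : XuP := (apair a).1.
Let src (a : A) : XuP := (apair a).2.
Let one (x : XuP) : A := @StableArrow R W P (x, x) (stable_equiv_refl x).
Let inv (a : A) : A :=
  @StableArrow R W P (src a, rng a) (stable_equiv_sym (apairP a)).

Let mulP (a b : A) : src a = rng b -> Gs (rng a, src b).
Proof.
move=> ab; apply: (@stable_equiv_trans _ _ (src a)); first exact: (apairP a).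
by rewrite ab; exact: (apairP b).
Qed.

Let mul (a b : A) (ab : src a = rng b) : A := StableArrow (mulP ab).

Let mul1 a (e : src a = rng (one (src a))) : mul e = a.
Proof. by apply: stableArrow_inj; rewrite /= [RHS]surjective_pairing. Qed.

Let mul1l a (e : src (one (rng a)) = rng a) : mul e = a.
Proof. by apply: stableArrow_inj; rewrite /= [RHS]surjective_pairing. Qed.

Let mulV a (e : src a = rng (inv a)) : mul e = one (rng a).
Proof. exact: stableArrow_inj. Qed.

Let mulVl a (e : src (inv a) = rng a) : mul e = one (src a).
Proof. exact: stableArrow_inj. Qed.

Let mulA a b c (ab : src a = rng b) (bc : src b = rng c)
  (ab_c : src (mul ab) = rng c) (a_bc : src a = rng (mul bc)) :
  mul ab_c = mul a_bc.
Proof. exact: stableArrow_inj. Qed.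

Definition stable_groupoid : groupoid :=
  @Groupoid XuP A rng src one inv mul
    (fun=> erefl) (fun=> erefl) (fun=> erefl) (fun=> erefl)
    (fun a b ab => erefl) (fun a b ab => erefl) mul1 mul1l mulV mulVl mulA.

End stable_groupoid.

Section Gk.
Variables (R : realType) (W : wieler R) (P : invariantSet W) (epsY : R).
Local Notation XuP := (unstableSpace P).

Definition pi0 (x : XuP) : W := x 0%N.

Definition sim0 (x y : XuP) : Prop :=
  pi0 x = pi0 y /\
  exists delta : R, 0 < delta < epsY /\
  exists U : set XuP, [/\ open U, U `<=` unstable_ball y epsY &
    pi0 @` unstable_ball x delta = pi0 @` U].

Definition Gk (k : nat) : set (XuP * XuP) :=
  [set p | sim0 (iter k (@phiU R W P) p.1) (iter k (@phiU R W P) p.2)].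

Definition Gk_arrows (k : nat) : set (stable_groupoid P) :=
  @apair R W P @^-1` Gk k.

End Gk.

(* Main.v *)
(* On pairs whose coordinates all stay within beta, Axiom 1 says that the distances
   of the coordinates contract by gamma^K every K steps.  Hence a local unstable
   set is determined by, and has the topology of, its zeroth coordinates, and two
   points are stably equivalent exactly when their zeroth coordinates merge under
   some g^k.  Axiom 2 yields the converse existence statement: if phi^k(x) and
   phi^k(y) agree in coordinates 0, ..., 2K, then every z unstably close to y has
   an x' unstably close to x with g^k(x'_0) = g^k(z_0).  It follows that, for k
   large, the pairs (x', y') near (x, y) with g^k(x'_0) = g^k(y'_0) are a
   neighborhood base of the arrow (x, y), from which the topological statements
   are read off.  Finally x ~_0 y is the symmetric condition that the local
   unstable sets of x and y have the same germ of zeroth-coordinate images at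
   x_0 = y_0; it is preserved by phi and open in G^s(P), and by Axiom 2 it holds
   for phi^k(x), phi^k(y) as soon as these agree in coordinates 0, ..., 2K. *)
Require Import Defs.
From mathcomp Require Import all_boot all_order all_algebra.
From mathcomp Require Import all_classical all_reals all_analysis.
From mathcomp Require Import zify lra.
Import Order.TTheory GRing.Theory Num.Theory.
Import numFieldNormedType.Exports.
Local Open Scope classical_set_scope.
Local Open Scope ring_scope.

Set Implicit Arguments.
Unset Strict Implicit.
Unset Printing Implicit Defensive.

(** * Coordinates of a Wieler solenoid *)

Section wieler_metric.
Variables (R : realType) (W : wieler R).
Local Notation g := (@wmap R W).
Local Notation K := (wK W).
Local Notation gamma := (wgamma W).
Local Notation beta := (wbeta W).
Implicit Types (u v : W) (e : R).

(** Heine-Cantor: compactness, in its near-covering form, gives one modulus of continuity for [g],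
    and induction on [m] gives one for the iterates up to [m]. *)
Lemma iter_wmap_unif m e : 0 < e -> exists2 r, 0 < r &
  forall i u v, (i <= m)%N -> mdist u v < r ->
    mdist (iter i g u) (iter i g v) < e.
Proof.
elim: m e => [|m IH] e e0.
  by exists e => // i u v; rewrite leqn0 => /eqP ->.
have [s s0 gs] : exists2 s, 0 < s &
    forall u v, mdist u v < s -> mdist (g u) (g v) < e.
  have /compact_near_coveringP := @wieler_compact R W.
  move=> /(_ R (0^'+) (fun r u => forall v, mdist u v < r ->
    mdist (g u) (g v) < e) _) cov.
  have [u _|s /= s0 sP] := cov.
    have e20 : 0 < e / 2 by rewrite divr_gt0.
    have := @wieler_continuous R W u _ (nbhsx_ballx (g u) _ e20).
    rewrite /= nbhs_simpl /= -nbhs_ballE => -[d /= d0 dP].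
    have d20 : 0 < d / 2 by rewrite divr_gt0.
    exists (ball u (d / 2), [set r | r < d / 2]) => /=.
      by split; [exact: nbhsx_ballx | exact: nbhs_right_lt].
    move=> [u' r] /= []; rewrite ballEmdist /= => uu' rd v u'v.
    have [] : mdist (g u) (g u') < e / 2 /\ mdist (g u) (g v) < e / 2.
      split.
        have := dP u'; rewrite !ballEmdist /=; apply; lra.
      have := dP v; rewrite !ballEmdist /=; apply.
      have := metric_triangle u u' v; lra.
    have := metric_triangle (g u') (g u) (g v).
    rewrite (metric_sym (g u') (g u)); lra.
  exists (s / 2); first by rewrite divr_gt0.
  have ss : `|0 - s / 2| < s by rewrite sub0r normrN gtr0_norm; lra.
  move=> u v uv; apply: (sP _ ss) => //; lra.
have [r r0 rP] := IH _ s0.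
exists (Num.min r e); first by rewrite lt_min r0.
move=> [|i] u v; first by rewrite lt_min => _ /andP[].
by rewrite lt_min ltnS => im /andP[uv _] /=; apply/gs/rP.
Qed.

Lemma wgamma_le1 : gamma <= 1.
Proof. by rewrite ltW ?wgamma_lt1. Qed.

Lemma wgammaX_ge0 n : 0 <= gamma ^+ n.
Proof. by rewrite exprn_ge0// ltW// wgamma_gt0. Qed.

Lemma wgammaX_le1 n : gamma ^+ n <= 1.
Proof. by rewrite exprn_ile1 ?wgamma_le1// ltW ?wgamma_gt0. Qed.

Lemma wgammaX_cvg0 (C e : R) : 0 < e ->
  exists N, forall n, (N <= n)%N -> gamma ^+ n * C < e.
Proof.
move=> e0.
have : (fun n => gamma ^+ n * C) @ \oo --> (0 : R).
  rewrite -[0](mul0r C); apply: cvgMl; apply: cvg_expr.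
  by rewrite gtr0_norm ?wgamma_gt0 ?wgamma_lt1.
move/cvgrPdist_lt => /(_ _ e0) [N _ NP]; exists N => n /NP /=.
by rewrite sub0r normrN; exact/le_lt_trans/ler_norm.
Qed.

(* Otherwise, by Axiom 1, the distance of the orbits would grow geometrically. *)
Lemma small_orbits_merge u v :
  (forall n, mdist (iter n g u) (iter n g v) <= beta) ->
  iter K g u = iter K g v.
Proof.
move=> uv; apply: mdist_positivity; apply/eqP; rewrite eq_le mdist_ge0 andbT.
(* Axiom 1 at the times 0, K, 2K, ...: each application moves the right-hand side K steps ahead and
   gains a factor [gamma ^+ K], while [beta] bounds the distance throughout. *)
have step j : mdist (iter K g u) (iter K g v) <= gamma ^+ (j * K) * beta.
  suff : mdist (iter K g u) (iter K g v) <= gamma ^+ (j * K) *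
      mdist (iter (j.+1 * K) g u) (iter (j.+1 * K) g v).
    move/le_trans; apply; exact/ler_wpM2l/uv/wgammaX_ge0.
  elim: j => [|j IH]; first by rewrite mul0n expr0 mul1r mul1n.
  apply: (le_trans IH).
  have -> : gamma ^+ (j.+1 * K) = gamma ^+ (j * K) * gamma ^+ K.
    by rewrite mulSn addnC exprD.
  rewrite -mulrA ler_wpM2l ?wgammaX_ge0//.
  have := wieler_axiom1 (uv (j * K)%N).
  by rewrite -!iterD -mulnDl -mulSn.
apply/ler_addgt0Pr => e e0; rewrite add0r.
have [N NP] := wgammaX_cvg0 beta e0.
apply: (le_trans (step N)); apply/ltW/NP.
by rewrite leq_pmulr ?wK_gt0.
Qed.

End wieler_metric.

(** * Local unstable sets in terms of coordinates *)

Section solenoid_coordinates.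
Variables (R : realType) (W : wieler R).
Local Notation g := (@wmap R W).
Local Notation K := (wK W).
Local Notation gamma := (wgamma W).
Local Notation beta := (wbeta W).
Local Notation X := (solenoid W).
Local Notation phi := (@phi R W).
Local Notation phiV := (@phiV R W).
Implicit Types (x y z : X) (e : R).

Lemma coord_iter x i n : iter i g (x (i + n)%N) = x n.
Proof. by elim: i n => [|i IH] n //=; rewrite addSnnS IH coordP. Qed.

Lemma coord_iter_sub x i n : (n <= i)%N -> iter (i - n) g (x i) = x n.
Proof. by move=> ni; rewrite -{2}(subnK ni) coord_iter. Qed.

Lemma iter_coord_sub x k m : (m <= k)%N ->
  iter k g (x m) = iter (k - m) g (x 0%N).
Proof.
by move=> mk; rewrite -{1}(subnK mk) iterD -(coord_iter x m 0) addn0.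
Qed.

Lemma iter_phiE x i n : iter i phi x n = iter i g (x n).
Proof.
elim: i n => [|i IH] //= [|n] /=; first by rewrite IH.
by rewrite IH -iterS iterSr coordP.
Qed.

Lemma iter_phiVE x i n : iter i phiV x n = x (i + n)%N.
Proof. by elim: i n => [|i IH] //= n; rewrite IH addnS. Qed.

Lemma iter_phiK i : cancel (iter i phi) (iter i phiV).
Proof.
by move=> x; apply: solenoid_ext => n; rewrite iter_phiVE iter_phiE coord_iter.
Qed.

Lemma iter_phiVK i : cancel (iter i phiV) (iter i phi).
Proof.
by move=> x; apply: solenoid_ext => n; rewrite iter_phiE iter_phiVE coord_iter.
Qed.

Lemma mdist0_le x y : mdist (x 0%N) (y 0%N) <= mdist x y.
Proof.
by apply: le_trans (dist'_le_dist x y); have := dist'_ub x y 0; rewrite mul1r.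
Qed.

Lemma mdist_solenoid_lt e : 0 < e -> exists2 r, 0 < r &
  forall x y, (forall n, mdist (x n) (y n) < r) -> mdist x y < e.
Proof.
(* The metric has [K.+1] summands, each only weakly bounded by [e1]; dividing by [K.+2] makes the
   total strictly less than [e]. *)
move=> e0; pose e1 := e / K.+2%:R.
have e10 : 0 < e1 by rewrite divr_gt0.
have [r r0 rP] := iter_wmap_unif W K e10.
exists r => // x y xy; rewrite mdist_solenoid /dist big_mkord.
apply: (@le_lt_trans _ _ (\sum_(i < K.+1) e1)); last first.
  rewrite sumr_const card_ord -mulr_natr /e1 mulrAC ltr_pdivrMr//.
  by rewrite ltr_pM2l// ltr_nat.
apply: ler_sum => i _; apply: (@le_trans _ _ (1 * e1)); last by rewrite mul1r.
apply: ler_pM; rewrite ?wgammaX_ge0 ?dist'_ge0 ?wgammaX_le1//.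
apply: dist'_le => n; apply: (@le_trans _ _ (1 * e1)); last by rewrite mul1r.
apply: ler_pM; rewrite ?wgammaX_ge0 ?mdist_ge0 ?wgammaX_le1//.
by rewrite !iter_phiE; apply/ltW/rP => //; rewrite -ltnS.
Qed.

Lemma local_unstable_near e : 0 < e -> exists2 r, 0 < r &
  forall x y, (forall n, mdist (x n) (y n) < r) -> local_unstable x e y.
Proof.
move=> e0; have [r r0 rP] := mdist_solenoid_lt e0.
exists (Num.min r e); first by rewrite lt_min r0.
move=> x y xy; split => [n|]; first by have := xy n; rewrite lt_min => /andP[].
by apply: rP => n; have := xy n; rewrite lt_min => /andP[].
Qed.

Lemma local_unstable_le x y e e' : e <= e' ->
  local_unstable x e y -> local_unstable x e' y.
Proof.
move=> ee' [xy dxy]; split=> [n|]; last exact: lt_le_trans ee'.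
exact: lt_le_trans ee'.
Qed.

Lemma local_unstablexx x e : 0 < e -> local_unstable x e x.
Proof. by move=> e0; split=> [n|]; rewrite mdistxx. Qed.

Lemma local_unstable_sym x y e : local_unstable x e y -> local_unstable y e x.
Proof. by move=> [xy dxy]; split=> [n|]; rewrite metric_sym. Qed.

Lemma local_unstable_trans y x z e e' :
  local_unstable x e y -> local_unstable y e' z -> local_unstable x (e + e') z.
Proof.
move=> [xy dxy] [yz dyz]; split=> [n|].
  by apply: le_lt_trans (metric_triangle _ (y n) _) _; rewrite ltrD.
by apply: le_lt_trans (metric_triangle _ y _) _; rewrite ltrD.
Qed.

(** The condition under which Axiom 1 applies at every coordinate. Two points of one local unstable
    set of radius [epsX] satisfy it, since [epsX] is half of [beta]. *)
Definition beta_close x y := forall n, mdist (x n) (y n) <= beta.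

Lemma local_unstable_beta_close x y : local_unstable x (epsX W) y -> beta_close x y.
Proof.
move=> [xy _] n; apply: ltW; apply: lt_le_trans (xy n) _.
by rewrite /epsX; have := wbeta_gt0 W; lra.
Qed.

Lemma local_unstable_beta_close2 x y z : local_unstable x (epsX W) y ->
  local_unstable x (epsX W) z -> beta_close y z.
Proof.
move=> [xy _] [xz _] n; have := metric_triangle (y n) (x n) (z n).
by rewrite (metric_sym (y n) (x n)); have := xy n; have := xz n; rewrite /epsX; lra.
Qed.

(** Axiom 1 at the coordinates of index [K + n], whose images under [g^K] are those of index [n]. *)
Lemma beta_close_contract x y n : beta_close x y ->
  mdist (x n) (y n) <= gamma ^+ K * mdist (iter K g (x n)) (iter K g (y n)).
Proof.
move=> xy; have := wieler_axiom1 (xy (K + n)%N).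
by rewrite mulSn mul1n !iterD !coord_iter.
Qed.

Lemma beta_close_coord x y n : beta_close x y -> (K <= n)%N ->
  mdist (x n) (y n) <= gamma ^+ K * mdist (x (n - K)%N) (y (n - K)%N).
Proof.
move=> /beta_close_contract xy Kn; apply: le_trans (xy n) _.
by rewrite -{1 2}(subnKC Kn) !coord_iter.
Qed.

(** Contraction reduces coordinate [n] to coordinate [n - K]. Below K, the bound is by
    [g^K(x_n) = g^(K-n)(x_0)], which uniform continuity controls through the zeroth coordinates. *)
Lemma beta_close_local_unstable e : 0 < e -> exists2 r, 0 < r &
  forall x y, beta_close x y -> mdist (x 0%N) (y 0%N) < r ->
    local_unstable x e y.
Proof.
move=> e0; have [e1 e10 e1P] := local_unstable_near e0.
have [r r0 rP] := iter_wmap_unif W K e10.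
exists r => // x y xy xy0; apply: e1P => n.
elim/ltn_ind: n => n IH.
have [Kn|nK] := leqP K n.
  apply: le_lt_trans (beta_close_coord xy Kn) _.
  apply: (@le_lt_trans _ _ (1 * mdist (x (n - K)%N) (y (n - K)%N))).
    by rewrite ler_wpM2r ?mdist_ge0 ?wgammaX_le1.
  by rewrite mul1r; apply: IH; rewrite -subn_gt0 subKn ?wK_gt0.
apply: le_lt_trans (beta_close_contract n xy) _.
rewrite !(iter_coord_sub _ (ltnW nK)).
set d := mdist _ _; apply: (@le_lt_trans _ _ (1 * d)).
  by rewrite ler_wpM2r ?mdist_ge0 ?wgammaX_le1.
by rewrite mul1r; apply: rP => //; exact: leq_subr.
Qed.

Lemma beta_close_inj x y : beta_close x y -> x 0%N = y 0%N -> x = y.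
Proof.
move=> xy xy0; apply: mdist_positivity; apply/eqP; rewrite eq_le mdist_ge0 andbT.
apply/ler_addgt0Pr => e e0; rewrite add0r ltW//.
have [r r0 rP] := beta_close_local_unstable e0.
by have [|_ +] := rP _ _ xy; rewrite // xy0 mdistxx.
Qed.

Lemma beta_close_decay x y : beta_close x y ->
  exists C, forall n, mdist (x n) (y n) <= gamma ^+ n * C.
Proof.
(* The factor [gamma ^- K] serves the coordinates below K, where only the bound [beta] is
   available. *)
move=> xy; exists (gamma ^- K * beta) => n; elim/ltn_ind: n => n IH.
have beta0 := ltW (wbeta_gt0 W).
have gK0 : 0 < gamma ^+ K by rewrite exprn_gt0 ?wgamma_gt0.
have [Kn|nK] := leqP K n.
  apply: le_trans (beta_close_coord xy Kn) _.
  have -> : gamma ^+ n = gamma ^+ K * gamma ^+ (n - K) by rewrite -exprD subnKC.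
  rewrite -mulrA ler_pM2l//; apply: IH.
  by rewrite -subn_gt0 subKn ?wK_gt0.
apply: le_trans (xy n) _; rewrite mulrA ler_peMl// ler_pdivlMr// mul1r.
by apply: ler_wiXn2l; [exact/ltW/wgamma_gt0|exact: wgamma_le1|exact: ltnW].
Qed.

Lemma beta_close_unstable x y : beta_close x y -> unstable_equiv x y.
Proof.
move=> /beta_close_decay [C CP]; apply/cvgrPdist_lt => e e0.
have [r r0 rP] := mdist_solenoid_lt e0; have [N NP] := wgammaX_cvg0 W C r0.
exists N => // n /= Nn; rewrite sub0r normrN ger0_norm ?mdist_ge0//.
apply: rP => m; rewrite !iter_phiVE; apply: le_lt_trans (CP _) _.
by apply: NP; rewrite (leq_trans Nn)// leq_addr.
Qed.

(** Infinitely many strict inequalities leave no uniform margin in general. Here contraction bounds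
    all coordinate distances by the maximum [M] over the first K of them, so [M < e] leaves room. *)
Lemma local_unstable_open x z e : e <= epsX W -> local_unstable x e z ->
  exists2 e', 0 < e' &
    forall y, local_unstable z e' y -> local_unstable x e y.
Proof.
move=> ee xz; have xz_close := local_unstable_beta_close (local_unstable_le ee xz).
case: xz => [xz dxz].
have [M [MP Me]] : exists M, (forall n, mdist (x n) (z n) <= M) /\ M < e.
  pose M := \big[Num.max/0]_(i < K) mdist (x i) (z i).
  exists M; split => [n|]; last first.
    apply: bigmax_lt => [|i _]; last exact: xz.
    exact: le_lt_trans (mdist_ge0 _ _) dxz.
  elim/ltn_ind: n => n IH; have [Kn|nK] := leqP K n.
    apply: le_trans (beta_close_coord xz_close Kn) _.
    apply: (@le_trans _ _ (1 * mdist (x (n - K)%N) (z (n - K)%N))).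
      by rewrite ler_wpM2r ?mdist_ge0 ?wgammaX_le1.
    by rewrite mul1r; apply: IH; rewrite -subn_gt0 subKn ?wK_gt0.
  exact: (le_bigmax _ (fun i : 'I_K => mdist (x i) (z i)) (Ordinal nK)).
exists (Num.min (e - M) (e - mdist x z)); first by rewrite lt_min !subr_gt0 Me.
move=> y [zy dzy]; split => [n|].
  have := zy n; rewrite lt_min => /andP[zyn _].
  by have := metric_triangle (x n) (z n) (y n); have := MP n; lra.
move: dzy; rewrite lt_min => /andP[_].
by have := metric_triangle x z y; lra.
Qed.

End solenoid_coordinates.

(** * Bracket and holonomy maps *)

Section bracket_holonomy.
Variables (R : realType) (W : wieler R).
Local Notation g := (@wmap R W).
Local Notation K := (wK W).
Local Notation gamma := (wgamma W).
Local Notation beta := (wbeta W).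
Local Notation X := (solenoid W).
Local Notation phi := (@phi R W).
Local Notation phiV := (@phiV R W).
Implicit Types (x y z : X) (e : R).

(** Axiom 2 lifts [z] backwards along [y]: from [a_0 = z_(2K)] it builds [a_j] near [y_((j+2)K)]
    with [g^(2K)(a_(j+1)) = g^K(a_j)]. Hence the points [g^K(a_j)] can serve as the coordinates of
    index [(j+1)K] of one point [w]. *)
Lemma shadowing_point e : 0 < e -> exists2 r, 0 < r &
  forall y z, mdist (y (2 * K)%N) (z (2 * K)%N) < r ->
  exists2 w : X, forall m, (m <= K)%N -> w m = z m &
    forall n, mdist (y n) (w n) < e.
Proof.
move=> e0; have [r0 r00 r0P] := iter_wmap_unif W (2 * K) e0.
exists (Num.min r0 beta); first by rewrite lt_min r00 wbeta_gt0.
set r := Num.min _ _ => y z yz.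
have rb : 0 < r <= beta by rewrite ge_min lexx orbT andbT lt_min r00 wbeta_gt0.
have K_gt0 := wK_gt0 W.
(* One step of the recursion: Axiom 2 at [y_((j+3)K)], whose image under [g^K] is [y_((j+2)K)]. The
   radius [gamma * r] obtained is at most [r], so the step can be repeated. *)
have /choice [f fP] : forall p : nat * W, exists b,
    mdist (y (p.1.+2 * K)%N) p.2 < r ->
    mdist (y (p.1.+3 * K)%N) b < r /\ iter (2 * K) g b = iter K g p.2.
  move=> [j a] /=; have [ya|_] := boolP (mdist (y (j.+2 * K)%N) a < r);
    last by exists a.
  have := @wieler_axiom2 R W (y (j.+3 * K)%N) r rb (iter K g a).
  have -> : iter K g (y (j.+3 * K)%N) = y (j.+2 * K)%N by rewrite mulSn coord_iter.
  case; first by exists a => //; rewrite ballEmdist.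
  move=> b; rewrite ballEmdist /= => yb ba; exists b => _; split => //.
  apply: lt_le_trans yb _; rewrite ger_pMl ?wgamma_le1//.
  by case/andP: rb.
pose a n := iteri n (fun j c => f (j, c)) (z (2 * K)%N).
have aP j : mdist (y (j.+2 * K)%N) (a j) < r.
  by elim: j => [|j IH] //=; have [] := fP (j, a j) IH.
have aS j : iter (2 * K) g (a j.+1) = iter K g (a j).
  by have [] := fP (j, a j) (aP j).
(* Coordinate [n] is read off from coordinate [(n+1)K], which is at least [n] because K is positive;
   this avoids a division by K. *)
pose b n := iter (n.+1 * K - n) g (iter K g (a n)).
have bP n : g (b n.+1) = b n.
  rewrite /b -iterS -!iterD.
  have -> : ((n.+2 * K - n.+1).+1 + K = (n.+1 * K - n) + 2 * K)%N by nia.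
  by rewrite iterD aS -iterD.
have aD i j : iter (i * K) g (iter K g (a (i + j)%N)) = iter K g (a j).
  elim: i => [|i IH] //; rewrite -{}IH -[in RHS]aS -!iterD.
  by congr (iter _ _ _); nia.
pose w : X := Solenoid bP.
have wK j : w (j.+1 * K)%N = iter K g (a j).
  rewrite -(aD (j.+1 * K - j)%N) subnK; last by nia.
  by rewrite /w /= /b; congr (iter _ _ _); nia.
exists w => [m mK|n].
  rewrite -(coord_iter_sub w mK) -(coord_iter_sub z mK); congr (iter _ _ _).
  have := wK 0; rewrite mul1n => ->.
  by rewrite /a /= mul2n -addnn coord_iter.
(* For the estimate, the nearest multiple of K above is used instead: [w_n] and [y_n] are images of
   [a_j] and [y_((j+2)K)] under one iterate of order at most 2K, the range covered by [r0]. *)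
pose j := (n %/ K)%N.
have nj : (n <= j.+1 * K)%N by rewrite ltnW// ltn_ceil.
have jn : (j.+1 * K - n <= K)%N.
  by rewrite leq_subLR mulSn addnC leq_add2r leq_trunc_div.
rewrite -(coord_iter_sub w nj) -(coord_iter_sub y nj) wK.
rewrite -(coord_iter y K) -mulSn -!iterD; apply: r0P; first by lia.
by have := aP j; rewrite lt_min => /andP[].
Qed.

(** From some time [N] on, the zeroth coordinates stay within [beta], so they coincide K steps
    later; coordinate [m] takes [m] further steps. *)
Lemma stable_agree x y M : stable_equiv x y ->
  exists k0, forall k, (k0 <= k)%N -> forall m, (m <= M)%N ->
    iter k g (x m) = iter k g (y m).
Proof.
move=> xy.
have [N _ NP] : \forall n \near \oo,
    mdist (iter n phi x) (iter n phi y) <= beta.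
  have /cvgrPdist_le /(_ _ (wbeta_gt0 W)) := xy; apply: filterS => n.
  by rewrite sub0r normrN ger0_norm ?mdist_ge0.
have NK : iter K g (iter N g (x 0%N)) = iter K g (iter N g (y 0%N)).
  apply: small_orbits_merge => n; rewrite -!iterD -!iter_phiE.
  by apply: le_trans (mdist0_le _ _) (NP _ _); rewrite /= leq_addl.
exists (K + N + M)%N => k kP m mM.
have mk : (m <= k)%N by lia.
rewrite !(iter_coord_sub _ mk).
have /subnK <- : (K + N <= k - m)%N by lia. by rewrite !iterD NK.
Qed.

(** After [n] steps the points agree in the coordinates up to [n - k], and the remaining ones carry
    a weight of at most [gamma ^+ (n - k)] in the metric. *)
Lemma agree_stable x y k :
  iter k g (x 0%N) = iter k g (y 0%N) -> stable_equiv x y.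
Proof.
move=> xy; have [M MP] := wieler_bounded W; apply/cvgrPdist_lt => e e0.
have [N NP] := wgammaX_cvg0 W (K.+1%:R * M) e0.
exists (N + k)%N => // n /= Nn; rewrite sub0r normrN ger0_norm ?mdist_ge0//.
have M0 : 0 <= M by rewrite (le_trans _ (MP (x 0%N) (x 0%N)))// mdist_ge0.
apply: le_lt_trans (NP (n - k)%N _); last by lia.
rewrite mdist_solenoid /dist big_mkord mulrCA.
rewrite -[X in _ <= X%:R * _](card_ord K.+1) mulr_natl -sumr_const.
apply: ler_sum => i _; apply: (@le_trans _ _ (1 * (gamma ^+ (n - k) * M))).
  2: by rewrite mul1r.
apply: ler_pM; rewrite ?wgammaX_ge0 ?dist'_ge0 ?wgammaX_le1//.
apply: dist'_le => m; have [mn|nm] := leqP m (n - k).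
  have -> : iter i phi (iter n phi x) m = iter i phi (iter n phi y) m.
    rewrite !iter_phiE; congr (iter _ _ _).
    have mk : (m <= n)%N by lia.
    rewrite !(iter_coord_sub _ mk).
    have /subnK <- : (k <= n - m)%N by lia.
    by rewrite !iterD xy.
  by rewrite mdistxx mulr0 mulr_ge0// wgammaX_ge0.
apply: ler_pM; rewrite ?wgammaX_ge0 ?mdist_ge0//.
by apply: ler_wiXn2l; [exact/ltW/wgamma_gt0|exact: wgamma_le1|exact: ltnW].
Qed.

Lemma local_unstable_phi k e : 0 < e -> exists2 r, 0 < r &
  forall x y, local_unstable x r y ->
    local_unstable (iter k phi x) e (iter k phi y).
Proof.
move=> e0; have [s s0 sP] := local_unstable_near W e0.
have [r r0 rP] := iter_wmap_unif W k s0; exists r => // x y [xy _].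
by apply: sP => n; rewrite !iter_phiE; exact: rP.
Qed.

Lemma local_unstable_phiV k e : 0 < e -> exists2 r, 0 < r &
  forall x y, local_unstable x r y ->
    local_unstable (iter k phiV x) e (iter k phiV y).
Proof.
move=> e0; have [s s0 sP] := local_unstable_near W e0.
by exists s => // x y [xy _]; apply: sP => n; rewrite !iter_phiVE.
Qed.

Lemma local_unstable_eq x y z e : e <= epsX W -> local_unstable x e y ->
  local_unstable x e z -> y 0%N = z 0%N -> y = z.
Proof.
move=> ee xy xz; apply: beta_close_inj.
by apply: (@local_unstable_beta_close2 _ _ x); exact: local_unstable_le ee _.
Qed.

Lemma epsX_gt0 : 0 < epsX W.
Proof. by rewrite divr_gt0// wbeta_gt0. Qed.

(** The zeroth coordinate of [phi^k(y)] is [g^k(y_0)], so this is injectivity of the zeroth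
    coordinate near [phi^k(x)], pulled back. It identifies points that are constructed in different
    ways. *)
Lemma local_unstable_iter_eq k : exists2 e, 0 < e & forall x y z,
  local_unstable x e y -> local_unstable x e z ->
  iter k g (y 0%N) = iter k g (z 0%N) -> y = z.
Proof.
have [e e0 eP] := local_unstable_phi k epsX_gt0.
exists e => // x y z /eP xy /eP xz; rewrite -!iter_phiE => yz.
exact: (can_inj (@iter_phiK _ _ k) (local_unstable_eq (lexx _) xy xz yz)).
Qed.

(** Shadowing of [phi^k(z)] along [phi^k(x)], pulled back by [phi^k]. Agreement in coordinate 2K
    turns closeness of [z] to [y] into the closeness to [phi^k(x)] that shadowing asks for. *)
Lemma local_holonomy x y k e : 0 < e ->
  (forall m, (m <= 2 * K)%N -> iter k g (x m) = iter k g (y m)) ->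
  exists2 r, 0 < r & forall z, local_unstable y r z ->
  exists2 x', local_unstable x e x' &
    forall m, (m <= K)%N -> iter k g (x' m) = iter k g (z m).
Proof.
move=> e0 xy; have [e1 e10 e1P] := local_unstable_near W e0.
have [s s0 sP] := shadowing_point e10.
have [r r0 rP] := iter_wmap_unif W k s0; exists r => // z [yz _].
have [|w wz w_near] := sP (iter k phi x) (iter k phi z).
  by rewrite !iter_phiE xy//; apply: rP.
exists (iter k phiV w) => [|m mK]; last first.
  by rewrite -iter_phiE iter_phiVK wz// iter_phiE.
apply: e1P => n; rewrite iter_phiVE -{1}(coord_iter x k n) -iter_phiE.
exact: w_near.
Qed.

Lemma bracket_set_inj x y p q :
  bracket_set x y p -> bracket_set x y q -> p = q.
Proof.
move=> [[xp _] yp] [[xq _] yq]; apply: (local_unstable_eq (lexx _) yp yq).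
by rewrite xp ?xq ?wK_gt0.
Qed.

Lemma bracketP x y : bracket_set x y !=set0 -> bracket_set x y (bracket x y).
Proof. by case=> p pP; exact: xgetI pP. Qed.

Lemma holonomyP x k z : bracket_set (iter k phi z) (iter k phi x) !=set0 ->
  bracket_set (iter k phi z) (iter k phi x) (iter k phi (holonomy x k z)).
Proof. by move=> /bracketP; rewrite /holonomy iter_phiVK. Qed.

Lemma holonomyE x k z x' :
  bracket_set (iter k phi z) (iter k phi x) (iter k phi x') ->
  holonomy x k z = x'.
Proof.
move=> bx'; apply: (can_inj (@iter_phiK _ _ k)).
by apply: (bracket_set_inj _ bx'); apply: holonomyP; exists (iter k phi x').
Qed.

Lemma holonomy_coord x k z : bracket_set (iter k phi z) (iter k phi x) !=set0 ->
  iter k g (holonomy x k z 0%N) = iter k g (z 0%N).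
Proof.
move=> /holonomyP[[zx _] _]; have := zx _ (wK_gt0 W).
by rewrite !iter_phiE.
Qed.

Variable P : invariantSet W.

(** For [k] large, the point given by [local_holonomy] lies in the bracket set, so it is the value
    of the holonomy map, which is therefore defined near [y] and takes values near [x]. *)
Lemma holonomy_domain_exists (x y : unstableSpace P) : stable_equiv x y ->
  exists k0, forall k, (k0 <= k)%N -> forall e, 0 < e ->
  exists d, [/\ d <= e, holonomy_domain x y k d &
    forall z, local_unstable y d z -> local_unstable x e (holonomy x k z)].
Proof.
move=> xy; have [k1 k1P] := stable_agree (2 * K) xy.
have eps2 : 0 < epsX W / 2 by rewrite divr_gt0 ?epsX_gt0.
have eps4 : 0 < epsX W / 4 by rewrite divr_gt0 ?epsX_gt0.
have [k2 _ k2P] : \forall n \near \oo,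
    mdist (iter n phi x) (iter n phi y) < epsX W / 2.
  have /cvgrPdist_lt /(_ _ eps2) := xy; apply: filterS => n.
  by rewrite sub0r normrN ger0_norm ?mdist_ge0.
exists (maxn k1 k2) => k; rewrite geq_max => /andP[/k1P kagree /k2P /= kdist] e e0.
have [s s0 sP] := local_unstable_phi k eps4.
have se0 : 0 < Num.min s e by rewrite lt_min s0.
have [r r0 rP] := local_holonomy se0 kagree.
pose d := Num.min (Num.min r s) (Num.min e (epsX W)).
have [[dr ds] [de dX]] : (d <= r /\ d <= s) /\ (d <= e /\ d <= epsX W).
  by rewrite /d !ge_min !lexx !orbT.
have d0 : 0 < d by rewrite /d !lt_min r0 s0 e0 epsX_gt0.
have brk z : local_unstable y d z -> exists2 x', local_unstable x e x' &
    bracket_set (iter k phi z) (iter k phi x) (iter k phi x').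
  move=> yz; have [x' xx' x'z] := rP z (local_unstable_le dr yz).
  exists x'; first by apply: local_unstable_le xx'; rewrite ge_min lexx orbT.
  have kxx' : local_unstable (iter k phi x) (epsX W / 4) (iter k phi x').
    by apply: sP; apply: local_unstable_le xx'; rewrite ge_min lexx.
  split; last by apply: local_unstable_le kxx'; have := epsX_gt0; lra.
  split=> [m mK|]; first by rewrite !iter_phiE x'z// ltnW.
  (* The path from [phi^k(z)] through [phi^k(y)] and [phi^k(x)] to [phi^k(x')] has length below
     [epsX/4 + epsX/2 + epsX/4]. *)
  have [_ kyz] := sP _ _ (local_unstable_le ds yz); case: kxx' => _ kxx'.
  have := metric_triangle (iter k phi z) (iter k phi y) (iter k phi x').
  have := metric_triangle (iter k phi y) (iter k phi x) (iter k phi x').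
  rewrite (metric_sym (iter k phi z) (iter k phi y)).
  rewrite (metric_sym (iter k phi y) (iter k phi x)); lra.
exists d; split => //; last first.
  by move=> z /brk [x' xx' /holonomyE ->].
split; first by rewrite d0.
- split=> [m mK|]; last by rewrite metric_sym.
  by rewrite !iter_phiE kagree// (leq_trans (ltnW mK))// leq_pmull.
- move=> _ [z yz <-]; apply: local_unstable_le (sP _ _ (local_unstable_le ds yz)).
  by have := epsX_gt0; lra.
- by move=> z /brk [x' _ bx']; exists (iter k phi x').
Qed.

End bracket_holonomy.

(** * Open subgroupoids *)

(** On the interior of [U] the map is injective, and its openness is the continuity of the
    inverse. *)
Lemma local_homeomorphismP (S T : topologicalType) (f : S -> T) :
  continuous f ->
  (forall (x : S) A, nbhs x A -> nbhs (f x) (f @` A)) ->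
  (forall x : S, exists2 U, nbhs x U &
    forall y z, U y -> U z -> f y = f z -> y = z) ->
  local_homeomorphism f.
Proof.
move=> cf of_ injf x; have [U xU Uinj] := injf x.
have Uo := open_interior U; have Usub := @interior_subset _ U.
have fUo : open (f @` U°).
  rewrite openE => _ [t Ut <-]; apply: of_.
  by move: Ut; exact: nbhs_interior.
exists U°; split => //; first exact: continuous_subspaceT.
pose f' y := xget x (U° `&` f @^-1` [set y]).
have fK t : U° t -> f' (f t) = t.
  move=> Ut; have [Uf ff] : (U° `&` f @^-1` [set f t]) (f' (f t)).
    by apply: (@xgetI _ _ _ t).
  by apply: Uinj ff; exact: Usub.
exists f'; split; last by move=> t /set_mem; exact: fK.
rewrite continuous_open_subspace// => _ /set_mem [t Ut <-] A.
rewrite /= fK // => tA; change (nbhs (f t) (f' @^-1` A)).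
apply: filterS (of_ t _ (filterI (nbhs_interior Ut) tA)) => _ [s [Us As] <-] /=.
by rewrite fK.
Qed.

Lemma continuous_pair (S T U : topologicalType) (f : S -> T) (h : S -> U) :
  continuous f -> continuous h -> continuous (fun x => (f x, h x)).
Proof. by move=> cf ch x; apply: cvg_pair; [exact: cf|exact: ch]. Qed.

Section subspace_groupoid.
Variables (G : groupoid) (H : set G) (sH : subgroupoid H).

Lemma set_val_continuous (T : topologicalType) (A : set T) :
  continuous (set_val : A -> T).
Proof. exact: initial_continuous. Qed.

Lemma continuous_into_set_type (S T : topologicalType) (A : set T) (f : S -> A) :
  continuous (fun x => set_val (f x)) -> continuous f.
Proof. exact: continuous_comp_initial. Qed.

Lemma subgroupoid_topological : topological_groupoid G ->
  topological_groupoid (subgroupoid_groupoid sH).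
Proof.
case=> cr cs c1 cV cM; split.
- move=> a; apply: (@continuous_comp _ _ _ (@set_val _ H) (@grange G)).
    exact: set_val_continuous.
  exact: cr.
- move=> a; apply: (@continuous_comp _ _ _ (@set_val _ H) (@gsource G)).
    exact: set_val_continuous.
  exact: cs.
- exact: continuous_into_set_type.
- apply: continuous_into_set_type => a.
  apply: (@continuous_comp _ _ _ (@set_val _ H) (@ginv G)).
    exact: set_val_continuous.
  exact: cV.
- apply: continuous_into_set_type.
  (* Multiplication in the subgroupoid is that of [G] composed with the inclusion [v] of composable
     pairs. *)
  pose v (p : set_type (@composable (subgroupoid_groupoid sH))) :
    set_type (@composable G) :=
    SigSub (mem_set (set_valP p :
      composable (set_val (set_val p).1, set_val (set_val p).2))).
  have cv : continuous v.
    pose C := set_type (@composable (subgroupoid_groupoid sH)).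
    apply: continuous_into_set_type; apply: continuous_pair => p.
      apply: (@continuous_comp C H G (fun p => (set_val p).1) set_val).
        apply: (@continuous_comp C (H * H)%type H set_val fst).
          exact: set_val_continuous.
        exact: cvg_fst.
      exact: set_val_continuous.
    apply: (@continuous_comp C H G (fun p => (set_val p).2) set_val).
      apply: (@continuous_comp C (H * H)%type H set_val snd).
        exact: set_val_continuous.
      exact: cvg_snd.
    exact: set_val_continuous.
  have -> : (fun p => set_val (@composable_mul (subgroupoid_groupoid sH) p)) =
      (@composable_mul G) \o v.
    apply/funext => p /=; rewrite /composable_mul /=.
    by congr gmul; exact: Prop_irrelevance.
  by move=> p; apply: continuous_comp; [exact: cv|exact: cM].
Qed.

Lemma local_homeomorphism_open_sub (T : topologicalType) (f : G -> T) :
  open H -> continuous f ->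
  (forall (a : G) A, nbhs a A -> nbhs (f a) (f @` A)) ->
  (forall a : G, exists2 U, nbhs a U &
    forall b c, U b -> U c -> f b = f c -> b = c) ->
  local_homeomorphism (fun a : H => f (set_val a)).
Proof.
move=> oH cf of_ injf; apply: local_homeomorphismP.
- by move=> a; apply: continuous_comp; [exact: set_val_continuous|exact: cf].
- move=> a A [_ [[B oB <-] Ba BA]].
  have Ha : H (set_val a) := set_valP a.
  have : nbhs (set_val a) (B `&` H).
    by apply: open_nbhs_nbhs; split => //; exact: openI.
  move=> /of_; apply: filterS => _ [b [Bb Hb] <-].
  by exists (SigSub (mem_set Hb)) => //; exact: BA.
- move=> a; have [U aU Uinj] := injf (set_val a).
  exists (set_val @^-1` U); first exact: set_val_continuous.
  by move=> b c Ub Uc bc; apply: val_inj; exact: Uinj.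
Qed.

End subspace_groupoid.

(** Both topologies are generated by a subbase; since filters are closed under finite intersections,
    comparing neighborhoods with a filter needs only the subbase sets. *)
Lemma finI_from_filter (T : Type) (F : set_system T) (D : set (set T)) (x : T) :
  Filter F -> (forall B, D B -> B x -> F B) ->
  forall A, finI_from D id A -> A x -> F A.
Proof.
move=> FF DF _ [Q QD <-] Qx.
by apply: filter_bigI => B BQ; apply: DF (Qx _ BQ); exact/set_mem/QD.
Qed.

(** * The topologies of X^u(P) and G^s(P) *)

Section unstable_topology.
Variables (R : realType) (W : wieler R) (P : invariantSet W).
Local Notation g := (@wmap R W).
Local Notation XuP := (unstableSpace P).
Local Notation phi := (@phi R W).
Local Notation phiV := (@phiV R W).
Implicit Types (x y z : XuP) (e : R).

Lemma unstable_ball_open x e : 0 < e <= epsX W -> open (unstable_ball x e).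
Proof.
move=> e0; exists [set unstable_ball x e]; last by rewrite bigcup_set1.
move=> A ->; exists (finmap.fset1 (unstable_ball x e)); last first.
  by rewrite set_fset1 bigcap_set1.
by move=> B; rewrite finmap.in_fset1 => /eqP ->; apply/mem_set; exists x, e.
Qed.

Lemma unstable_ball_filter x :
  Filter (filter_from (fun e : R => 0 < e) (unstable_ball x)).
Proof.
apply: filter_from_filter; first by exists 1 => /=.
move=> e1 e2 e10 e20; exists (Num.min e1 e2); first by rewrite lt_min e10.
by move=> y xy; split; apply: local_unstable_le xy; rewrite ge_min lexx ?orbT.
Qed.

(** A generating ball around another center contains a ball around each of its points by
    [local_unstable_open], so balls centered at [x] suffice. *)
Lemma nbhs_unstableP x (S : set XuP) :
  nbhs x S <-> exists2 e, 0 < e & unstable_ball x e `<=` S.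
Proof.
split=> [[_ [[I ID <-] [B IB Bx] IS]]|[e e0 eS]].
  have /= := finI_from_filter (@unstable_ball_filter x) _ (ID _ IB) Bx.
  case=> [_ [z [d [/andP[d0 dX] ->]]] zx|e e0 eB].
    have [e e0 eP] := local_unstable_open dX zx.
    by exists e => // y /eP.
  by exists e => // y /eB By; apply: IS; exists B.
have m0 : 0 < Num.min e (epsX W) <= epsX W.
  by rewrite lt_min e0 epsX_gt0 ge_min lexx orbT.
apply: filterS (open_nbhs_nbhs (conj (unstable_ball_open x m0) _)).
  by move=> y xy; apply: eS; apply: local_unstable_le xy; rewrite ge_min lexx.
by apply: local_unstablexx; case/andP: m0.
Qed.

Lemma global_unstable_beta_close x (y : solenoid W) :
  beta_close x y -> global_unstable P y.
Proof.
move=> xy; have [p Pp xp] := upointP x; exists p => //.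
have yx : unstable_equiv y x.
  by apply: beta_close_unstable => n; rewrite metric_sym; exact: xy.
have := cvgD yx xp _; rewrite addr0 => yxp.
apply: (squeeze_cvgr _ (cvg_cst 0) (yxp _)); apply: nearW => n /=.
by rewrite mdist_ge0; exact: metric_triangle.
Qed.

Lemma local_unstable_lift x (y : solenoid W) e : e <= epsX W ->
  local_unstable x e y -> exists2 y' : XuP, upoint y' = y & unstable_ball x e y'.
Proof.
move=> ee xy; have yP : global_unstable P y.
  apply: (@global_unstable_beta_close x); apply: local_unstable_beta_close.
  exact: local_unstable_le ee xy.
by exists (UnstableSpace yP).
Qed.

(** Only forward invariance is given. The set is finite, so the forward orbit of [p] repeats; as
    [phi] is injective, [p] is periodic and its preimage lies on its forward orbit. *)
Lemma ipoints_phiV p : ipoints P p -> ipoints P (phiV p).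
Proof.
move=> Pp; have itP n : ipoints P (iter n phi p).
  by elim: n => [|n IH] //=; apply: ipoints_phi; exists (iter n phi p).
have [i [j [ij eq_ij]]] : exists i j, (i < j)%N /\ iter i phi p = iter j phi p.
  apply: contrapT => no; apply: infinite_nat.
  have inj : {in setT &, injective (fun n => iter n phi p)}.
    move=> i j _ _ ij; apply: contrapT => /eqP; rewrite neq_ltn => /orP[] lt_ij.
      by apply: no; exists i, j.
    by apply: no; exists j, i.
  rewrite -(eq_finite_set (inj_card_eq inj)).
  apply: sub_finite_set (ipoints_finite P) => _ [n _ <-]; exact: itP.
suff -> : phiV p = iter (j - i).-1 phi p by exact: itP.
apply: (can_inj (@phiK R W)); rewrite phiVK -iterS prednK ?subn_gt0//.
apply: (can_inj (@iter_phiK _ _ i)); rewrite eq_ij -iterD.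
by rewrite subnKC// ltnW.
Qed.

Lemma global_unstable_phiV x : global_unstable P (phiV x).
Proof.
have [p Pp xp] := upointP x; exists (phiV p); first exact: ipoints_phiV.
have : (fun n => mdist (iter n.+1 phiV x) (iter n.+1 phiV p)) @ \oo --> (0 : R).
  by move: xp; rewrite /unstable_equiv -cvg_shiftS.
by rewrite /unstable_equiv; under eq_fun do rewrite !iterSr.
Qed.

Definition phiUV x : XuP := UnstableSpace (global_unstable_phiV x).

Lemma iter_phiU k x : upoint (iter k (@phiU R W P) x) = iter k phi x.
Proof. by elim: k => //= k ->. Qed.

Lemma iter_phiUV k x : upoint (iter k phiUV x) = iter k phiV x.
Proof. by elim: k => //= k ->. Qed.

Lemma iter_phiUK k : cancel (iter k (@phiU R W P)) (iter k phiUV).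
Proof.
by move=> x; apply: unstable_inj; rewrite iter_phiUV iter_phiU iter_phiK.
Qed.

Lemma iter_phiUVK k : cancel (iter k phiUV) (iter k (@phiU R W P)).
Proof.
by move=> x; apply: unstable_inj; rewrite iter_phiU iter_phiUV iter_phiVK.
Qed.

Lemma iter_phiU_homeomorphism k : homeomorphism (iter k (@phiU R W P)).
Proof.
split; last exists (iter k phiUV).
  move=> x S /nbhs_unstableP [e e0 eS].
  have [r r0 rP] := local_unstable_phi W k e0.
  apply/nbhs_unstableP; exists r => // y /rP xy; apply: eS.
  by rewrite /unstable_ball /= !iter_phiU.
split; [|exact: iter_phiUK|exact: iter_phiUVK].
move=> x S /nbhs_unstableP [e e0 eS].
have [r r0 rP] := local_unstable_phiV W k e0.
apply/nbhs_unstableP; exists r => // y /rP xy; apply: eS.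
by rewrite /unstable_ball /= !iter_phiUV.
Qed.

End unstable_topology.

(** * Merging neighborhoods and the topology of the stable groupoid *)

Section stable_topology.
Variables (R : realType) (W : wieler R) (P : invariantSet W).
Local Notation g := (@wmap R W).
Local Notation K := (wK W).
Local Notation XuP := (unstableSpace P).
Local Notation A := (stableArrow P).
Local Notation phi := (@phi R W).
Implicit Types (x y z : XuP) (a b : A) (e : R).

(* For each large [k] these sets form a neighborhood base at [a]. *)
Definition merging_nbhd k a e : set A :=
  [set b | [/\ local_unstable (apair a).1 e (apair b).1,
               local_unstable (apair a).2 e (apair b).2 &
               iter k g (pi0 (apair b).1) = iter k g (pi0 (apair b).2)]].

Lemma merging_nbhd_le k l a e e' : (k <= l)%N -> e <= e' ->
  merging_nbhd k a e `<=` merging_nbhd l a e'.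
Proof.
move=> kl ee b [b1 b2 b12]; split; try exact: local_unstable_le ee _.
by rewrite -(subnK kl) !iterD b12.
Qed.

Lemma stable_base_open (B : set A) : stable_base B -> open B.
Proof.
move=> BP; exists [set B]; last by rewrite bigcup_set1.
move=> _ ->; exists (finmap.fset1 B); last by rewrite set_fset1 bigcap_set1.
by move=> C; rewrite finmap.in_fset1 => /eqP ->; exact/mem_set.
Qed.

(** A basic set around [a], the graph of a holonomy map, lies inside: [h(z)] stays near the range of
    [a], and it merges with [z] under [g^k]. *)
Lemma merging_nbhd_nbhs a : exists k0, forall k, (k0 <= k)%N ->
  forall e, 0 < e -> nbhs a (merging_nbhd k a e).
Proof.
have [k0 k0P] := holonomy_domain_exists (apairP a).
exists k0 => k /k0P kP e /kP [d [de dom hol]].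
have [/andP[d0 dX] st _ ex] := dom.
pose B := [set b : A | unstable_ball (apair a).2 d (apair b).2 /\
  upoint (apair b).1 = holonomy (apair a).1 k (apair b).2].
have oB : open B.
  apply: stable_base_open; exists (apair a).1, (apair a).2, k, d; split => //.
  by have := apairP a; rewrite [apair a]surjective_pairing.
apply: filterS (open_nbhs_nbhs (conj oB _)) => [b [ab eb]|].
  split; [by rewrite eb; exact: hol|exact: local_unstable_le ab|].
  by rewrite /pi0 eb; apply: holonomy_coord; exact: ex.
(* The arrow [a] belongs to [B]: [phi^k] of its range is itself the bracket point, so holonomy sends
   the source of [a] to its range. *)
split; first exact: local_unstablexx.
apply/esym/holonomyE; split; last exact: local_unstablexx (epsX_gt0 _).
case: st => st1 st2; split=> //; apply: lt_trans st2 _.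
by have := epsX_gt0 W; lra.
Qed.

(** If [b] is near [a] and merges under [g^k], then the range of [b] and the holonomy image of its
    source are both unstably near the range of [a] and have the same image under [g^k] in coordinate
    zero; hence they coincide. *)
Lemma stable_base_merging a (B : set A) : stable_base B -> B a ->
  exists k0, forall k, (k0 <= k)%N -> exists2 e, 0 < e & merging_nbhd k a e `<=` B.
Proof.
case=> x0 [y0 [k0 [d [_ [/andP[d0 dX] _ _ ex] ->]]]] [/= a2 a1].
exists k0 => k k0k.
have [s s0 sP] := local_unstable_iter_eq W k.
have [q q0 qP] := local_unstable_phiV W k0 s0.
have [r r0 rP] := beta_close_local_unstable W q0.
have [t t0 tP] := iter_wmap_unif W k0 r0.
have [e1 e10 e1P] := local_unstable_open dX a2.
pose e := Num.min (Num.min s t) e1.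
have [[es et] ee1] : (e <= s /\ e <= t) /\ e <= e1.
  by rewrite /e !ge_min !lexx !orbT.
exists e; first by rewrite /e !lt_min s0 t0 e10.
move=> b [b1 b2 b12].
have yb : local_unstable y0 d (apair b).2.
  by apply: e1P; exact: local_unstable_le ee1 b2.
split => //=; apply: (sP (apair a).1).
- exact: local_unstable_le es b1.
(* The two holonomy images are compared after [phi^k0]: there they share a local unstable set, and
   their zeroth coordinates are the images under [g^k0] of those of the sources. *)
- have hb := holonomyP (ex _ yb); have ha := holonomyP (ex _ a2).
  rewrite -[X in local_unstable X](@iter_phiK _ _ k0).
  rewrite -[X in local_unstable _ _ X](@iter_phiK _ _ k0).
  apply: qP; apply: rP.
    rewrite a1; apply: local_unstable_beta_close2; [exact: ha.2|exact: hb.2].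
  rewrite !iter_phiE a1 !holonomy_coord; [|exact: ex|exact: ex].
  by apply: tP => //; case: b2 => /(_ 0%N) b2 _; exact: lt_le_trans b2 et.
- rewrite [LHS]b12 -(subnK k0k) !iterD; congr (iter _ _ _).
  by apply/esym/holonomy_coord; exact: ex.
Qed.

Lemma nbhs_merging a (S : set A) : nbhs a S -> exists k0, forall k, (k0 <= k)%N ->
  exists2 e, 0 < e & merging_nbhd k a e `<=` S.
Proof.
(* Merging neighborhoods grow with [k], so asking for all large [k], and not for some [k], is what
   makes [F] closed under intersections. *)
pose F : set_system A := [set S | exists k0, forall k, (k0 <= k)%N ->
  exists2 e, 0 < e & merging_nbhd k a e `<=` S].
have FF : Filter F.
  split; first by exists 0%N => k _; exists 1.
  - move=> S1 S2 [k1 k1P] [k2 k2P]; exists (maxn k1 k2) => k.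
    rewrite geq_max => /andP[/k1P [e1 e10 e1S] /k2P [e2 e20 e2S]].
    exists (Num.min e1 e2); first by rewrite lt_min e10.
    move=> b ab; split; [apply: e1S|apply: e2S];
      by apply: merging_nbhd_le ab; rewrite ?leqnn// ge_min lexx ?orbT.
  - move=> S1 S2 S12 [k1 k1P]; exists k1 => k /k1P [e e0 eS].
    by exists e => // b /eS /S12.
case=> _ [[I ID <-] [B IB Ba] IS].
have [k0 k0P] := finI_from_filter FF (@stable_base_merging a) (ID _ IB) Ba.
exists k0 => k /k0P [e e0 eB]; exists e => // b /eB Bb.
by apply: IS; exists B.
Qed.

End stable_topology.

(** * The stable groupoid is topological and étale; [phi] acts on its arrows *)

Section stable_groupoid_topology.
Variables (R : realType) (W : wieler R) (P : invariantSet W).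
Local Notation g := (@wmap R W).
Local Notation K := (wK W).
Local Notation XuP := (unstableSpace P).
Local Notation A := (stableArrow P).
Local Notation G := (stable_groupoid P).
Local Notation phi := (@phi R W).
Local Notation phiV := (@phiV R W).
Implicit Types (x y z : XuP) (a b : A) (e : R).

(** The shift [c] allows [f] to delay merging: the inverse of [phi^k] delays it by [k] steps,
    whereas inversion and [phi^k] cause no delay. *)
Lemma arrow_map_continuous (f : A -> A) (c : nat) :
  (forall a k e, 0 < e -> exists2 e', 0 < e' &
    forall b, merging_nbhd k a e' b -> merging_nbhd (k + c) (f a) e (f b)) ->
  continuous f.
Proof.
move=> fP a S /nbhs_merging [k0 k0P]; have [k1 k1P] := merging_nbhd_nbhs a.
have [e e0 eS] := k0P (maxn k0 k1 + c)%N (leq_trans (leq_maxl _ _) (leq_addr _ _)).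
have [e' e'0 e'P] := fP a (maxn k0 k1) e e0.
apply: filterS (k1P _ (leq_maxr k0 k1) _ e'0) => b /e'P /eS.
exact.
Qed.

Lemma stable_grange_continuous : continuous (@grange G).
Proof.
move=> a S /nbhs_unstableP [e e0 eS]; have [k kP] := merging_nbhd_nbhs a.
by apply: filterS (kP k (leqnn k) e e0) => b [b1 _ _]; exact: eS.
Qed.

Lemma stable_gsource_continuous : continuous (@gsource G).
Proof.
move=> a S /nbhs_unstableP [e e0 eS]; have [k kP] := merging_nbhd_nbhs a.
by apply: filterS (kP k (leqnn k) e e0) => b [_ b2 _]; exact: eS.
Qed.

Lemma stable_ginv_continuous : continuous (@ginv G).
Proof.
apply: (@arrow_map_continuous _ 0) => a k e e0; exists e => // b [b1 b2 b12].
by rewrite addn0; split.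
Qed.

Lemma stable_groupoid_topological : topological_groupoid G.
Proof.
split.
- exact: stable_grange_continuous.
- exact: stable_gsource_continuous.
- move=> x S /nbhs_merging [k kP]; have [e e0 eS] := kP k (leqnn k).
  by apply/nbhs_unstableP; exists e => // y xy; exact: eS.
- exact: stable_ginv_continuous.
- move=> p S /nbhs_merging [k kP].
  have [k1 k1P] := merging_nbhd_nbhs (set_val p).1.
  have [k2 k2P] := merging_nbhd_nbhs (set_val p).2.
  (* Merging under a common [g^l] is transitive, so one [l] has to exceed the thresholds of both
     factors and of the product. *)
  pose l := maxn k (maxn k1 k2).
  have [kl [k1l k2l]] : (k <= l)%N /\ (k1 <= l)%N /\ (k2 <= l)%N by rewrite /l; lia.
  have [e e0 eS] := kP l kl.
  set N := merging_nbhd l (set_val p).1 e `*` merging_nbhd l (set_val p).2 e.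
  have pN : nbhs (set_val p) N.
    exists (merging_nbhd l (set_val p).1 e, merging_nbhd l (set_val p).2 e) => //=.
    by split; [exact: k1P|exact: k2P].
  have : nbhs p (set_val @^-1` N) by exact: set_val_continuous pN.
  apply: filterS => q /= [[q1 q2 q12] [q3 q4 q34]].
  apply: eS; split => //=; rewrite q12 -q34; congr (iter _ _ (pi0 _)).
  exact: set_valP q.
Qed.

(** Holonomy supplies, for each [z] near the source of [a], an arrow [(h(z), z)] inside the given
    neighborhood. *)
Lemma stable_gsource_open a (S : set A) : nbhs a S ->
  nbhs (@gsource G a) (@gsource G @` S).
Proof.
move=> /nbhs_merging [k0 k0P]; have [k1 k1P] := holonomy_domain_exists (apairP a).
pose k := maxn k0 k1.
have [e e0 eS] := k0P k (leq_maxl _ _).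
have m0 : 0 < Num.min e (epsX W) by rewrite lt_min e0 epsX_gt0.
have [d [de [/andP[d0 dX] _ _ ex] hol]] := k1P k (leq_maxr _ _) _ m0.
apply/nbhs_unstableP; exists d => // z yz.
have [|x' x'E xx'] := local_unstable_lift _ (hol z yz).
  by rewrite ge_min lexx orbT.
have x'z : iter k g (x' 0%N) = iter k g (z 0%N).
  by rewrite x'E; apply: holonomy_coord; exact: ex.
exists (StableArrow (agree_stable x'z : Gs (x', z))) => //; apply: eS; split => //=.
  by apply: local_unstable_le xx'; rewrite ge_min lexx.
by apply: local_unstable_le yz; rewrite (le_trans de)// ge_min lexx.
Qed.

(** Two arrows in one merging neighborhood with a common source have ranges with the same image
    under [g^k], and these are equal by [local_unstable_iter_eq]. *)
Lemma stable_gsource_locally_injective a : exists2 U, nbhs a U &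
  forall b c, U b -> U c -> @gsource G b = @gsource G c -> b = c.
Proof.
have [k kP] := merging_nbhd_nbhs a; have [e e0 eP] := local_unstable_iter_eq W k.
exists (merging_nbhd k a e); first exact: kP.
move=> b c [b1 b2 b12] [c1 c2 c12] bc; apply: stableArrow_inj.
rewrite [LHS]surjective_pairing [RHS]surjective_pairing; congr pair; last exact: bc.
apply/unstable_inj/(eP _ _ _ b1 c1); rewrite [LHS]b12 [RHS]c12.
by congr (iter _ _ (pi0 _)).
Qed.

Lemma stable_ginvK : involutive (@ginv G).
Proof. by move=> a; apply: stableArrow_inj; rewrite /= -surjective_pairing. Qed.

Lemma stable_grange_open a (S : set A) : nbhs a S ->
  nbhs (@grange G a) (@grange G @` S).
Proof.
move=> aS; have : nbhs (@ginv G a) (@ginv G @^-1` S).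
  by apply: stable_ginv_continuous; rewrite stable_ginvK.
move=> /stable_gsource_open; apply: filterS => _ [b Sb <-].
by exists (@ginv G b).
Qed.

Lemma stable_grange_locally_injective a : exists2 U, nbhs a U &
  forall b c, U b -> U c -> @grange G b = @grange G c -> b = c.
Proof.
have [U aU Uinj] := stable_gsource_locally_injective (@ginv G a).
exists (@ginv G @^-1` U); first exact: stable_ginv_continuous.
by move=> b c Ub Uc bc; apply: (can_inj stable_ginvK); exact: Uinj.
Qed.

Lemma open_subgroupoid_etale (H : set G) (sH : subgroupoid H) : open H ->
  etale (subgroupoid_groupoid sH).
Proof.
move=> oH; split.
- exact/subgroupoid_topological/stable_groupoid_topological.
- apply: (@local_homeomorphism_open_sub G H XuP (@grange G)) => //.
  + exact: stable_grange_continuous.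
  + exact: stable_grange_open.
  + exact: stable_grange_locally_injective.
- apply: (@local_homeomorphism_open_sub G H XuP (@gsource G)) => //.
  + exact: stable_gsource_continuous.
  + exact: stable_gsource_open.
  + exact: stable_gsource_locally_injective.
Qed.

Lemma phiA_subproof k a :
  Gs (iter k (@phiU R W P) (apair a).1, iter k (@phiU R W P) (apair a).2).
Proof.
have [j jP] := stable_agree 0 (apairP a); apply: (@agree_stable _ _ _ _ j) => /=.
rewrite !iter_phiU !iter_phiE -!iterD !(addnC j) !iterD.
by rewrite (jP j (leqnn j) 0%N).
Qed.

Definition phiA k a : A := StableArrow (phiA_subproof k a).

Lemma phiAV_subproof k a :
  Gs (iter k (@phiUV R W P) (apair a).1, iter k (@phiUV R W P) (apair a).2).
Proof.
have [j jP] := stable_agree k (apairP a); apply: (@agree_stable _ _ _ _ j) => /=.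
by rewrite !iter_phiUV !iter_phiVE addn0; exact: jP.
Qed.

Definition phiAV k a : A := StableArrow (phiAV_subproof k a).

Lemma phiAK k : cancel (phiA k) (phiAV k).
Proof.
move=> a; apply: stableArrow_inj; rewrite /= !iter_phiUK.
by rewrite -surjective_pairing.
Qed.

Lemma phiAVK k : cancel (phiAV k) (phiA k).
Proof.
move=> a; apply: stableArrow_inj; rewrite /= !iter_phiUVK.
by rewrite -surjective_pairing.
Qed.

Lemma phiA_continuous k : continuous (phiA k).
Proof.
apply: (@arrow_map_continuous _ 0) => a l e e0.
have [r r0 rP] := local_unstable_phi W k e0.
exists r => // b [/rP b1 /rP b2 b12]; rewrite addn0.
split; rewrite /= ?/pi0 !iter_phiU //.
by rewrite !iter_phiE -!iterD !(addnC l) !iterD; congr (iter _ _ _).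
Qed.

Lemma phiAV_continuous k : continuous (phiAV k).
Proof.
apply: (@arrow_map_continuous _ k) => a l e e0.
have [r r0 rP] := local_unstable_phiV W k e0.
exists r => // b [/rP b1 /rP b2 b12].
split; rewrite /= ?/pi0 !iter_phiUV //.
by rewrite !iter_phiVE !iterD !coord_iter.
Qed.

End stable_groupoid_topology.

(** * The relation ~_0 *)

Section sim0_germs.
Variables (R : realType) (W : wieler R).
Local Notation g := (@wmap R W).
Local Notation K := (wK W).
Local Notation X := (solenoid W).
Local Notation phi := (@phi R W).
Local Notation phiV := (@phiV R W).
Implicit Types (x y z w : X) (e : R).

(** Inclusion of germs of zeroth-coordinate images. The target radius is fixed at [epsX]; when [x]
    and [y] share their zeroth coordinate, [germ_sub_small] allows any smaller one. *)
Definition germ_sub x y : Prop := exists2 r, 0 < r &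
  forall z, local_unstable x r z ->
  exists2 w, local_unstable y (epsX W) w & w 0%N = z 0%N.

Definition germ_eq x y : Prop := [/\ x 0%N = y 0%N, germ_sub x y & germ_sub y x].

Lemma germ_sub_small x y e : x 0%N = y 0%N -> germ_sub x y -> 0 < e ->
  exists2 r, 0 < r & forall z, local_unstable x r z ->
  exists2 w, local_unstable y e w & w 0%N = z 0%N.
Proof.
move=> xy0 [r r0 rP] e0; have [q q0 qP] := beta_close_local_unstable W e0.
exists (Num.min r q); first by rewrite lt_min r0.
move=> z xz; have [|w yw wz] := rP z.
  by apply: local_unstable_le xz; rewrite ge_min lexx.
exists w => //; apply: qP; first exact: local_unstable_beta_close.
by rewrite wz -xy0; case: xz => /(_ 0%N); rewrite lt_min => /andP[].
Qed.

Lemma germ_sub_refl x : germ_sub x x.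
Proof. by exists (epsX W); [exact: epsX_gt0|move=> z xz; exists z]. Qed.

Lemma germ_sub_trans y x z : x 0%N = y 0%N ->
  germ_sub x y -> germ_sub y z -> germ_sub x z.
Proof.
move=> xy0 xy [r r0 rP]; have [s s0 sP] := germ_sub_small xy0 xy r0.
exists s => // u /sP [v /rP [w zw wv] vu].
by exists w => //; rewrite wv.
Qed.

Lemma germ_eq_refl x : germ_eq x x.
Proof. by split => //; exact: germ_sub_refl. Qed.

Lemma germ_eq_sym x y : germ_eq x y -> germ_eq y x.
Proof. by case. Qed.

Lemma germ_eq_trans y x z : germ_eq x y -> germ_eq y z -> germ_eq x z.
Proof.
case=> xy0 xy yx [yz0 yz zy]; split; first by rewrite xy0.
  exact: germ_sub_trans xy0 xy yz.
by apply: germ_sub_trans zy yx; rewrite yz0.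
Qed.

Lemma germ_sub_phi x y : x 0%N = y 0%N -> germ_sub x y -> germ_sub (phi x) (phi y).
Proof.
move=> xy0 xy; have [e e0 eP] := local_unstable_phi W 1%N (epsX_gt0 W).
have [r r0 rP] := germ_sub_small xy0 xy e0.
have [s s0 sP] := local_unstable_phiV W 1%N r0.
exists s => // z /sP /=; rewrite phiK => /rP [w /eP yw wz].
by exists (phi w) => //=; rewrite wz /= coordP.
Qed.

Lemma germ_eq_phi x y : germ_eq x y -> germ_eq (phi x) (phi y).
Proof.
case=> xy0 xy yx; split; first by rewrite /= xy0.
  exact: germ_sub_phi.
exact: germ_sub_phi.
Qed.

(** Holonomy at time 0 carries the unstable set of [x] into that of [y] and keeps the zeroth
    coordinates. *)
Lemma germ_sub_agree x y :
  (forall m, (m <= 2 * K)%N -> x m = y m) -> germ_sub x y.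
Proof.
move=> xy; have [|r r0 rP] := @local_holonomy _ _ y x 0 _ (epsX_gt0 W).
  by move=> m /xy.
exists r => // z /rP [w yw wz].
by exists w => //; exact: (wz 0%N).
Qed.

Lemma stable_germ_eq x y : stable_equiv x y ->
  exists k, germ_eq (iter k phi x) (iter k phi y).
Proof.
move=> /(@stable_agree _ _ _ _ (2 * K)) [k kP]; exists k.
have xy m : (m <= 2 * K)%N -> iter k phi x m = iter k phi y m.
  by move=> mK; rewrite !iter_phiE kP.
split; [exact: xy|exact: germ_sub_agree|].
by apply: germ_sub_agree => m /xy.
Qed.

(* A point of the unstable set of [x] with the same zeroth coordinate as [y'] is
   provided by the germ condition, and it is [x'] since both become equal under
   [phi^k]. *)
Lemma germ_eq_open x y k : germ_eq x y -> exists2 e, 0 < e & forall x' y',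
  local_unstable x e x' -> local_unstable y e y' ->
  iter k g (x' 0%N) = iter k g (y' 0%N) -> germ_eq x' y'.
Proof.
(* Inclusion of germs passes to nearby points by halving radii; merging under [g^k] serves only to
   equate the zeroth coordinates. *)
have sub_open (u v : X) : u 0%N = v 0%N -> germ_sub u v -> exists2 e, 0 < e &
    forall u' v' : X, local_unstable u e u' -> local_unstable v e v' ->
    germ_sub u' v'.
  move=> uv0 uv; have e20 : 0 < epsX W / 2 by rewrite divr_gt0 ?epsX_gt0.
  have [r r0 rP] := germ_sub_small uv0 uv e20.
  have r20 : 0 < r / 2 by rewrite divr_gt0.
  exists (Num.min (r / 2) (epsX W / 2)); first by rewrite lt_min r20.
  move=> u' v' uu' vv'; exists (r / 2) => // z u'z.
  have [|w vw wz] := rP z.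
    rewrite [r]splitr; apply: local_unstable_trans u'z.
    by apply: local_unstable_le uu'; rewrite ge_min lexx.
  exists w => //; rewrite [epsX W]splitr; apply: local_unstable_trans vw.
  apply: local_unstable_le (local_unstable_sym vv').
  by rewrite ge_min lexx orbT.
move=> [xy0 xy yx]; have [e1 e10 e1P] := sub_open _ _ xy0 xy.
have [e2 e20 e2P] := sub_open _ _ (esym xy0) yx.
have [e3 e30 e3P] := local_unstable_iter_eq W k.
have [e4 e40 e4P] := germ_sub_small (esym xy0) yx e30.
pose e := Num.min (Num.min e1 e2) (Num.min e3 e4).
have [[le1 le2] [le3 le4]] : (e <= e1 /\ e <= e2) /\ (e <= e3 /\ e <= e4).
  by rewrite /e !ge_min !lexx !orbT.
exists e; first by rewrite /e !lt_min e10 e20 e30.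
move=> x' y' xx' yy' x'y'.
have [w xw wy'] := e4P y' (local_unstable_le le4 yy').
have wx' : w = x'.
  by apply: (e3P x) => //; [exact: local_unstable_le le3 xx'|rewrite wy'].
split; first by rewrite -wx'.
  by apply: e1P; [exact: local_unstable_le le1 xx'|exact: local_unstable_le le1 yy'].
by apply: e2P; [exact: local_unstable_le le2 yy'|exact: local_unstable_le le2 xx'].
Qed.

(** * The relation [sim0] as equality of germs, and the groupoids it defines *)

Variables (P : invariantSet W) (epsY : R).
Hypotheses (epsY_gt0 : 0 < epsY) (epsY_le : epsY <= epsX W).

(** This form makes the symmetry and transitivity of [sim0] visible and frees it from [epsY]. *)
Lemma sim0P (x y : unstableSpace P) : sim0 epsY x y <-> germ_eq x y.
Proof.
split=> [[xy0 [d [/andP[d0 dY] [U [oU Uy xU]]]]]|[xy0 xy yx]].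
  have dX := le_trans (ltW dY) epsY_le.
  (* Some point of [U] has the zeroth coordinate of [y], and it is [y] because [pi0] is injective on
     the ball; so [U] is a neighborhood of [y]. *)
  have Uy_y : U y.
    have : (@pi0 _ _ P @` U) (pi0 x).
      by rewrite -xU; exists x => //; exact: local_unstablexx.
    case=> w Uw wx; suff <- : w = y by [].
    apply/unstable_inj/(local_unstable_eq epsY_le (Uy _ Uw)).
      exact: local_unstablexx.
    by rewrite -[RHS]xy0.
  split => //.
    exists d => // z xz; have [z' <- xz'] := local_unstable_lift dX xz.
    have : (@pi0 _ _ P @` U) (pi0 z') by rewrite -xU; exists z'.
    case=> w /Uy yw wz; exists (upoint w) => //; exact: local_unstable_le yw.
  have /nbhs_unstableP [r r0 rU] : nbhs y U by exact: open_nbhs_nbhs.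
  exists (Num.min r (epsX W)); first by rewrite lt_min r0 epsX_gt0.
  move=> w yw; have [|w' <- yw'] := local_unstable_lift _ yw.
    by rewrite ge_min lexx orbT.
  have : (@pi0 _ _ P @` unstable_ball x d) (pi0 w').
    rewrite xU; exists w' => //; apply: rU.
    by apply: local_unstable_le yw'; rewrite ge_min lexx.
  case=> z xz zw; exists (upoint z) => //; exact: local_unstable_le dX xz.
split => //; have [r1 r10 r1P] := yx.
pose e := Num.min r1 epsY.
have e0 : 0 < e by rewrite lt_min r10.
have [er1 eY] : e <= r1 /\ e <= epsY by rewrite /e !ge_min !lexx orbT.
have [d1 d10 d1P] := germ_sub_small xy0 xy e0.
pose d := Num.min d1 (epsY / 2).
have d0 : 0 < d by rewrite lt_min d10 divr_gt0.
have [dd1 dY] : d <= d1 /\ d < epsY.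
  rewrite /d !ge_min !lexx !gt_min; split => //; apply/orP; right; lra.
have dX : d <= epsX W by rewrite (le_trans (ltW dY)).
exists d; split; first by rewrite d0.
(* The part of the ball around [y] lying over the image of the ball around [x]. *)
pose U : set (unstableSpace P) := [set w | unstable_ball y e w /\
  exists2 z : unstableSpace P, unstable_ball x d z & pi0 z = pi0 w].
exists U; split; last 1 first.
- apply/seteqP; split=> [_ [z xz <-]|_ [w [_ [z xz <-]] <-]]; last by exists z.
  have [w yw wz] := d1P z (local_unstable_le dd1 xz).
  have [w' w'E yw'] := local_unstable_lift (le_trans eY epsY_le) yw.
  have w'z : pi0 w' = pi0 z by rewrite /pi0 w'E.
  by exists w' => //; split => //; exists z.
(* Near [w], the inclusion of the germ of [y] in that of [x] gives a point [z'] over [w']. Since [z]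
   and [z'] have close zeroth coordinates, [z'] is unstably near [z] and stays in the ball around
   [x]. *)
- rewrite openE => w [yw [z xz zw]].
  have [s s0 sP] := local_unstable_open dX xz.
  have [q q0 qP] := beta_close_local_unstable W s0.
  have [t t0 tP] := local_unstable_open (le_trans eY epsY_le) yw.
  apply/nbhs_unstableP; exists (Num.min q t); first by rewrite lt_min q0.
  move=> w' ww'; have yw' : unstable_ball y e w'.
    by apply: tP; apply: local_unstable_le ww'; rewrite ge_min lexx orbT.
  split => //; have [z' xz' z'w'] := r1P w' (local_unstable_le er1 yw').
  have [z2 z2E xz2] := local_unstable_lift (lexx _) xz'.
  exists z2; last by rewrite /pi0 z2E.
  apply: sP; apply: qP.
    apply: local_unstable_beta_close2 xz2; exact: local_unstable_le xz.
  rewrite z2E z'w' [X in mdist X](zw : z 0%N = w 0%N).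
  by case: ww' => /(_ 0%N); rewrite lt_min => /andP[].
- by move=> w [yw _]; exact: local_unstable_le yw.
Qed.

Lemma GkP k p : Gk (P := P) epsY k p <->
  germ_eq (iter k phi p.1) (iter k phi p.2).
Proof. by rewrite -!iter_phiU; exact: sim0P. Qed.

Lemma Gk_sub_Gs k : Gk (P := P) epsY k `<=` Gs (P := P).
Proof.
move=> p /GkP[+ _ _]; rewrite !iter_phiE; exact: agree_stable.
Qed.

Lemma Gk_nested k : Gk (P := P) epsY k `<=` Gk (P := P) epsY k.+1.
Proof. by move=> p /GkP /germ_eq_phi; rewrite -!iterS => /GkP. Qed.

Lemma Gs_bigcup : Gs (P := P) = \bigcup_k Gk (P := P) epsY k.
Proof.
apply/seteqP; split=> [p /stable_germ_eq [k pk]|p [k _]]; last exact: Gk_sub_Gs.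
by exists k => //; apply/GkP.
Qed.

Lemma Gk_subgroupoid k : subgroupoid (Gk_arrows (P := P) epsY k).
Proof.
split=> [x|a /GkP a_k|a b ab /GkP a_k /GkP b_k]; apply/GkP => /=.
- exact: germ_eq_refl.
- exact: germ_eq_sym.
- by apply: germ_eq_trans a_k _; move: ab => /= ->.
Qed.

Lemma Gk_arrows_open k : open (Gk_arrows (P := P) epsY k).
Proof.
have open0 : open (Gk_arrows (P := P) epsY 0).
  rewrite openE => a /GkP a0; have [k0 k0P] := merging_nbhd_nbhs a.
  have [e e0 eP] := germ_eq_open k0 a0.
  apply: filterS (k0P k0 (leqnn _) e e0) => b [b1 b2 b12].
  by apply/GkP; exact: eP b1 b2 b12.
(* The set for [k] is by definition the preimage under [phiA k] of the set for 0. *)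
have /continuousP cont := @phiA_continuous R W P k.
exact: (cont _ open0).
Qed.

(** Membership of [a] in the set for [k] is convertible to membership of [phiA k a] in the set for
    0, so the same proof is reused. *)
Definition Gk_iso k
    (a : subgroupoid_groupoid (Gk_subgroupoid k)) :
    subgroupoid_groupoid (Gk_subgroupoid 0) :=
  SigSub (mem_set (set_valP a : Gk_arrows epsY 0 (phiA k (set_val a)))).

Lemma Gk_iso_topological k :
  topological_groupoid_iso (G := subgroupoid_groupoid (Gk_subgroupoid k))
    (H := subgroupoid_groupoid (Gk_subgroupoid 0))
    (iter k (@phiU R W P)) (@Gk_iso k).
Proof.
split => //; last 1 first.
- split.
    apply: continuous_into_set_type => a.
    apply: (@continuous_comp _ _ _ (@set_val _ (Gk_arrows epsY k)) (phiA k)).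
      exact: set_val_continuous.
    exact: phiA_continuous.
  have invP (a : stable_groupoid P) :
      Gk_arrows epsY 0 a -> Gk_arrows epsY k (phiAV k a).
    by move=> a0; rewrite /Gk_arrows /Gk /= !iter_phiUVK.
  exists (fun a => SigSub (mem_set (invP _ (set_valP a)))); split.
  + apply: continuous_into_set_type => a.
    apply: (@continuous_comp _ _ _ (@set_val _ (Gk_arrows epsY 0)) (phiAV k)).
      exact: set_val_continuous.
    exact: phiAV_continuous.
  + by move=> a; apply: val_inj; exact: phiAK.
  + by move=> a; apply: val_inj; exact: phiAVK.
- by move=> a b ab fab; apply: val_inj; exact: stableArrow_inj.
- exact: iter_phiU_homeomorphism.
Qed.

End sim0_germs.

Theorem theorem0p1 (R : realType) (W : wieler R)
  (mixX : mixing (@phi R W))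
  (P : invariantSet W)
  (K0 : nat) (K0_ge : (wK W <= K0)%N)
  (K0P : forall x y : solenoid W,
    (forall i, (i <= K0)%N -> x i = y i) -> mdist x y < wbeta W / 4)
  (epsY : R) (epsY_bound : 0 < epsY < wbeta W / 4)
  (epsYP : forall x : solenoid W,
    iter K0 (@phi R W) @` local_unstable x epsY `<=`
    local_unstable (iter K0 (@phi R W) x) (wbeta W / 4)) :
  [/\ (forall k, Gk (P := P) epsY k `<=` Gs (P := P)),
      (forall k, Gk (P := P) epsY k `<=` Gk (P := P) epsY k.+1),
      Gs (P := P) = \bigcup_k Gk (P := P) epsY k &
      exists sub : forall k, subgroupoid (Gk_arrows (P := P) epsY k),
        (forall k, etale (subgroupoid_groupoid (sub k))) /\
        (forall k, exists f : subgroupoid_groupoid (sub k) ->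
                              subgroupoid_groupoid (sub 0%N),
          (forall a, apair (set_val (f a)) =
            (iter k (@phiU R W P) (apair (set_val a)).1,
             iter k (@phiU R W P) (apair (set_val a)).2)) /\
          topological_groupoid_iso
            (G := subgroupoid_groupoid (sub k))
            (H := subgroupoid_groupoid (sub 0%N))
            (iter k (@phiU R W P)) f)].
Proof.
case/andP: epsY_bound => epsY_gt0 epsY_lt.
have epsY_le : epsY <= epsX W by rewrite /epsX; have := wbeta_gt0 W; lra.
split; [exact: Gk_sub_Gs|exact: Gk_nested|exact: Gs_bigcup|].
exists (Gk_subgroupoid P epsY_gt0 epsY_le); split => k.
  exact/open_subgroupoid_etale/Gk_arrows_open.
exists (@Gk_iso _ _ P _ epsY_gt0 epsY_le k); split => //.
exact: Gk_iso_topological.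
Qed.
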